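(* Suppose that the weight matrix $\mathbf{A}$ satisfies the weight assumption stated in the context and that each $f_i$, $i\in\mathcal{V}$, is $\mu_i$-strongly convex; put $\mu=\min_i\mu_i$, with $\mu>0$. Let the sequences $\{\mathbf{x}_i(k)\}$, $i\in\mathcal{V}$, be generated by the quantized distributed subgradient algorithm described in the context. Let $\mathbf{x}^*$ be a solution of $\min_{\mathbf{x}\in\mathcal{X}}f(\mathbf{x})$, let $r(0)=\|\bar{\mathbf{x}}(0)-\mathbf{x}^*\|^2$, and let the stepsizes be $$\alpha(k)=\frac{a}{k+2}\ \text{ for } a\ge\frac1\mu,\qquad \beta(k)=\frac{b}{(k+2)^{2/3}}\ \text{ for } b\ge\frac{1}{1-\sigma_2}.$$ In addition, suppose that each node $i$ maintains a variable $\mathbf{z}_i$, initialized arbitrarily and updated as $$\mathbf{z}_i(k)=\frac{\sum_{t=0}^k\mathbf{x}_i(t)}{k+1}.$$ Then for all $i\in\mathcal{V}$ and $k\ge0$, $$\begin{aligned}\mathbb{E}\big[\|\mathbf{z}_i(k)-\mathbf{x}^*\|^2\big]\le{}&\left\{n\,\mathbb{E}[r(0)]+\frac{4n\,\mathbb{E}[\|\mathbf{Y}(0)\|](1+\ln(k+2))}{1-\sigma_2}+\frac{6L^2\alpha^2(0)(1+\ln(k+2))}{1-\beta(0)}\right\}\times\frac{1}{k+2}\\&+\left\{n\Delta^2\beta^2(0)+\frac{4L^2\alpha^2(0)}{\beta(0)\mu}+\frac{8n^2\sigma_2^2\Delta^2\beta^2(0)}{(1-\sigma_2)^2}+\fr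ac{27nL^2\alpha(0)}{\beta(0)(1-\sigma_2)^3}\right\}\times\frac{1}{(k+2)^{1/3}}.\end{aligned}$$
   Context: **Problem.** $\mathcal{V}=\{1,\dots,n\}$ is a set of nodes, $\mathcal{X}=[\ell^1,u^1]\times\cdots\times[\ell^d,u^d]\subset\mathbb{R}^d$ is a compact box, and for each $i\in\mathcal{V}$, $f_i:\mathcal{X}\to\mathbb{R}$ is convex (possibly nonsmooth) and $L_i$-Lipschitz for some $L_i\ge 0$. The problem is to minimize $f(\mathbf{x})=\sum_{i=1}^n f_i(\mathbf{x})$ over $\mathbf{x}\in\mathcal{X}$. For $\mathbf{x}\in\mathcal{X}$, $\mathbf{g}_i(\mathbf{x})$ denotes a subgradient of $f_i$ at $\mathbf{x}$, i.e. $f_i(\mathbf{y})\ge f_i(\mathbf{x})+\mathbf{g}_i(\mathbf{x})^T(\mathbf{y}-\mathbf{x})$ for all $\mathbf{y}$, with $\|\mathbf{g}_i(\mathbf{x})\|\le L_i$ (subgradients are bounded by the Lipschitz constants). The function $f_i$ is $\mu_i$-strongly convex if $f_i(\mathbf{y})-f_i(\mathbf{x})-\mathbf{g}_i(\mathbf{x})^T(\mathbf{y}-\mathbf{x})\ge\frac{\mu_i}{2}\|\mathbf{y}-\mathbf{x}\|^2$ for all $\mathbf{x},\mathbf{y}$. **Network and weight assumption.** $\mathcal{G}=(\mathcal{V},\mathcal{E})$, $\mathcal{E}\subset\mathcal{V}\times\mathcal{V}$, is a connected undirected graph; $\mathcal{N}_i=\{j:(i,j)\in\mathcal{E}\}$.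 The matrix $\mathbf{A}=[a_{ij}]\in\mathbb{R}^{n\times n}$ has $a_{ij}>0$ if and only if $(i,j)\in\mathcal{E}$ and $a_{ij}=0$ otherwise, is doubly stochastic ($\sum_i a_{ij}=\sum_j a_{ij}=1$), irreducible and aperiodic. Its largest singular value is $1$, and $\sigma_2\in(0,1)$ denotes its second largest singular value. **Random quantization.** For each coordinate $m\in\{1,\dots,d\}$, the interval $[\ell^m,u^m]$ carries a finite uniform grid $\ell^m=\tau_1\le\tau_2\le\cdots\le u^m$, containing both endpoints, with spacing $\Delta^m$. For a scalar $x\in[\tau_i,\tau_{i+1})$, with $p=(x-\tau_i)/\Delta^m$, the random quantization $\mathcal{Q}(x)$ equals $\tau_i$ with probability $1-p$ and $\tau_{i+1}$ with probability $p$ (and $\mathcal{Q}(\tau_i)=\tau_i$ for every grid point). For $\mathbf{x}\in\mathcal{X}$, $\mathcal{Q}(\mathbf{x})$ is obtained by quantizing each coordinate this way. **Algorithm.** Each node $i$ starts from an arbitrary $\mathbf{x}_i(0)\in\mathcal{X}$ and for $k\ge 0$ sets $$\mathbf{x}_i(k+1)=\mathcal{P}_{\mathcal{X}}\Big[(1-\beta(k))\mathbf{x}_i(k)+\beta(k)\sum_{j\in\mathcal{N}_i}a_{ij}\mathbf{q}_j(k)-\alpha(k)\mathbf{g}_i(\mathbf{x}_i(k))\Big],$$ where $\mathcal{P}_{\mathcal{X}}$ is Euclidean projection onto $\mathcal{X}$ and $\mathbf{q}_j(k)=\mathcal{Q}(\mathbf{x}_j(k))$, the quantization randomness being drawn afresh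 at each time $k$. **Notation.** $\bar{\mathbf{x}}(k)=\frac1n\sum_{i=1}^n\mathbf{x}_i(k)$; $\mathbf{Y}(k)\in\mathbb{R}^{n\times d}$ is the matrix whose $i$-th row is $(\mathbf{x}_i(k)-\bar{\mathbf{x}}(k))^T$, and $\|\mathbf{Y}(k)\|$ is its Frobenius norm; $L=\sum_{i=1}^n L_i$; $\Delta=\sum_{m=1}^d\Delta^m$.
   Formalization: The formal theorem additionally assumes β(0) < 1: at β(0) = 1 the term with denominator 1−β(0) is undefined, and for β(0) > 1 that term is negative and the bound can fail (e.g. x_i(0) = x*, k = 0 and a large). *)

(* Defs.v *)
(* MathComp-Analysis *)
From HB Require Import structures.
From mathcomp Require Import all_boot all_order all_algebra.
From mathcomp Require Import all_classical all_reals all_analysis.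

Set Implicit Arguments.
Unset Strict Implicit.
Unset Printing Implicit Defensive.

Import Order.TTheory GRing.Theory Num.Theory.
Import numFieldNormedType.Exports.

Local Open Scope classical_set_scope.
Local Open Scope ring_scope.

Section Euclidean.
Variable R : realType.

(* Frobenius norm; on row vectors it is the Euclidean norm.  (The library norm
   on matrices, `|M|, is the sup norm.) *)
Definition fnorm (p q : nat) (M : 'M[R]_(p, q)) : R :=
  Num.sqrt (\sum_(i < p) \sum_(j < q) M i j ^+ 2).

Definition dot (d : nat) (u v : 'rV[R]_d) : R := \sum_(m < d) u 0 m * v 0 m.

Definition box (d : nat) (l u : 'rV[R]_d) : set 'rV[R]_d :=
  [set x | forall m, l 0 m <= x 0 m <= u 0 m].

(* p is the Euclidean projection of v onto X; it is unique when X is convex. *)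
Definition is_proj (d : nat) (X : set 'rV[R]_d) (v p : 'rV[R]_d) : Prop :=
  X p /\ forall y, X y -> fnorm (v - p) <= fnorm (v - y).

Definition convex_on (d : nat) (X : set 'rV[R]_d) (f : 'rV[R]_d -> R) : Prop :=
  @convex_function R 'rV[R]_d X (f : 'rV[R]_d -> R^o).

Definition lipschitz_bound_on (d : nat) (X : set 'rV[R]_d) (L : R)
    (f : 'rV[R]_d -> R) : Prop :=
  forall x y, X x -> X y -> `|f x - f y| <= L * fnorm (x - y).

Definition subgradient_on (d : nat) (X : set 'rV[R]_d) (f : 'rV[R]_d -> R)
    (x v : 'rV[R]_d) : Prop :=
  forall y, X y -> f x + dot v (y - x) <= f y.

(* Strong convexity with respect to the subgradient selection g. *)
Definition strongly_convex_on (d : nat) (X : set 'rV[R]_d) (mu : R)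
    (f : 'rV[R]_d -> R) (g : 'rV[R]_d -> 'rV[R]_d) : Prop :=
  forall x y, X x -> X y ->
    mu / 2 * fnorm (y - x) ^+ 2 <= f y - f x - dot (g x) (y - x).

Definition minimizer_on (d : nat) (X : set 'rV[R]_d) (f : 'rV[R]_d -> R)
    (xs : 'rV[R]_d) : Prop :=
  X xs /\ forall y, X y -> f xs <= f y.

Definition is_min (n : nat) (v : 'I_n -> R) (mu : R) : Prop :=
  (exists i, v i = mu) /\ forall i, mu <= v i.

End Euclidean.

Section Network.
Variables (R : realType) (n : nat).

Definition doubly_stochastic (A : 'M[R]_n) : Prop :=
  [/\ forall i j, 0 <= A i j, forall i, \sum_j A i j = 1
    & forall j, \sum_i A i j = 1].

Definition irreducible_mx (A : 'M[R]_n) : Prop :=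
  forall i j, exists k : nat, 0 < (A ^+ k) i j.

(* For every i, the gcd of the return times {k >= 1 | (A^k)_ii > 0} is 1. *)
Definition aperiodic_mx (A : 'M[R]_n) : Prop :=
  forall (i : 'I_n) (p : nat),
    (forall k : nat, (0 < k)%N -> 0 < (A ^+ k) i i -> (p %| k)%N) -> p = 1%N.

(* Self-loops are allowed: aperiodicity may rely on them. *)
Definition connected_undirected (E : rel 'I_n) : Prop :=
  symmetric E /\ forall i j, connect E i j.

Definition weight_matrix (E : rel 'I_n) (A : 'M[R]_n) : Prop :=
  [/\ forall i j, (0 < A i j) = E i j, doubly_stochastic A,
      irreducible_mx A & aperiodic_mx A].

(* s lists the singular values of A in decreasing order, with multiplicity:
   they are the diagonal entries of a singular value decomposition
   A = U diag(s) V^T. *)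
Definition singular_values (A : 'M[R]_n) (s : seq R) : Prop :=
  [/\ size s = n, sorted >=%R s, all (fun c => 0 <= c) s
    & exists U V : 'M[R]_n,
        [/\ U *m U^T = 1%:M, V *m V^T = 1%:M
          & A = U *m diag_mx (\row_i s`_i) *m V^T]].

Definition second_singular_value (A : 'M[R]_n) (sigma : R) : Prop :=
  (1 < n)%N /\ exists2 s, singular_values A s & sigma = s`_1.

End Network.

Section Quantization.
Variable R : realType.

(* Delta m is the spacing of the grid l m, l m + Delta m, ..., u m; when
   N m = 0 the m-th interval is the single point l m. *)
Definition uniform_grid (d : nat) (l u Delta : 'rV[R]_d) (N : 'I_d -> nat) :
    Prop :=
  forall m, 0 < Delta 0 m /\ u 0 m = l 0 m + (N m)%:R * Delta 0 m.

Definition grid_point (l Delta : R) (s : int) : R := l + s%:~R * Delta.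

Definition grid_index (l Delta x : R) : int := Num.floor ((x - l) / Delta).

(* The law of the random quantization of x on the grid of origin l and step
   Delta.  At x = u the second atom lies beyond the grid but has weight 0. *)
Definition quant_law (l Delta x : R) (B : set R) : \bar R :=
  let s := grid_index l Delta x in
  let p := (x - grid_point l Delta s) / Delta in
  ((1 - p)%:E * \d_(grid_point l Delta s) B
   + p%:E * \d_(grid_point l Delta (s + 1)) B)%E.

End Quantization.

Section Process.
Context (disp : measure_display) (T : measurableType disp) (R : realType).
Variables (n d : nat).

(* A process assigns to each node and each time a random vector of R^d. *)
Definition process := 'I_n -> nat -> T -> 'rV[R]_d.

Definition random_process (x : process) : Prop :=
  forall i k m, measurable_fun [set: T] (fun w => x i k w 0 m).

(* The sigma-algebra generated by the states up to time k and the quantized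
   values before time k. *)
Definition history (x q : process) (k : nat) : set (set T) :=
  <<s [set A | exists i t m (B : set R), measurable B /\
        ((t <= k)%N /\ A = (fun w => x i t w 0 m) @^-1` B \/
         (t < k)%N /\ A = (fun w => q i t w 0 m) @^-1` B)] >>.

(* Given the history at time k, each coordinate of q j k has the quantization
   law of the same coordinate of x j k: for every event A of the history,
     P(A and q j k m in B) = E[1_A quant_law(x j k m)(B)].
   No assumption is made on the joint law of the coordinates and nodes. *)
Definition fresh_quantization (P : probability T R) (l Delta : 'rV[R]_d)
    (x q : process) : Prop :=
  forall j k m (A : set T) (B : set R), history x q k A -> measurable B ->
    P (A `&` [set w | B (q j k w 0%R m)]) =
    (\int[P]_(w in A)
       quant_law (l 0%R m) (Delta 0%R m) (x j k w 0%R m) B)%E.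

Definition quantized_subgradient (X : set 'rV[R]_d) (E : rel 'I_n)
    (A : 'M[R]_n) (g : 'I_n -> 'rV[R]_d -> 'rV[R]_d) (alpha beta : nat -> R)
    (x q : process) : Prop :=
  (forall i w, X (x i 0%N w)) /\
  forall i k w,
    is_proj X
      ((1 - beta k) *: x i k w
       + beta k *: (\sum_(j < n | E i j) A i j *: q j k w)
       - alpha k *: g i (x i k w))
      (x i k.+1 w).

Definition mean (x : process) (k : nat) (w : T) : 'rV[R]_d :=
  n%:R^-1 *: \sum_(i < n) x i k w.

Definition deviation (x : process) (k : nat) (w : T) : 'M[R]_(n, d) :=
  \matrix_(i < n, m < d) (x i k w - mean x k w) 0 m.

Definition time_average (x : process) : process :=
  fun i k w => k.+1%:R^-1 *: \sum_(t < k.+1) x i t w.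

End Process.

Definition step_alpha (R : realType) (a : R) (k : nat) : R := a / k.+2%:R.

Definition step_beta (R : realType) (b : R) (k : nat) : R :=
  b / (k.+2%:R `^ (2 / 3)).

(* Main.v *)
(* The Lyapunov function is S(k) = sum_i |x_i(k) - x*|^2.  One step of the
   algorithm moves node i to the projection of
     h_i + beta N_i - alpha g_i,   h_i = (1 - beta) x_i + beta sum_j a_ij x_j,
   where N_i = sum_j a_ij (q_j - x_j) is the quantization noise.  By the
   spectral gap, mixing decreases S by at least beta (1 - sigma2) |Y|^2, which
   absorbs the consensus errors, of order alpha L |Y|; strong convexity
   contributes the factor 1 - 2 alpha mu.  Since h_i depends only on the states
   at time k, <h_i - x*, N_i> has mean zero, so that
     E S(k+1) <= (1 - 2 alpha(k) mu) E S(k) + O(k^(-4/3)).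
   Multiplying by k + 2 and telescoping bounds the sum of the E S(t), hence by
   convexity E |z_i(k) - x*|^2.

   The subgradient selection g_i need not be measurable, so <g_i, N_i> need not
   have mean zero; it is bounded crudely, at the price of a term of order
   alpha beta.  The hypotheses force 5/8 <= beta(0) < 1, sigma2 <= 3/8 and
   alpha(0) L >= n |u - l| / 4; the last bound makes the contribution of S(0)
   smaller than the L^2 alpha(0)^2 term, so the terms in r(0) and Y(0) are not
   needed. *)
Require Import Defs.
From HB Require Import structures.
From mathcomp Require Import all_boot all_order all_algebra.
From mathcomp Require Import all_classical all_reals all_analysis.
From mathcomp Require Import measurable_realfun.
From mathcomp Require Import zify ring lra.

Set Implicit Arguments.
Unset Strict Implicit.
Unset Printing Implicit Defensive.

Import Order.TTheory GRing.Theory Num.Theory.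
Import numFieldNormedType.Exports.

Local Open Scope classical_set_scope.
Local Open Scope ring_scope.

(** * Euclidean geometry *)

Section Euclidean.
Variables (R : realType) (d : nat).
Implicit Types (u v w p y : 'rV[R]_d) (c : R).

Lemma dotC u v : dot u v = dot v u.
Proof. by apply: eq_bigr => m _; rewrite mulrC. Qed.

Lemma dotDl u v w : dot (u + v) w = dot u w + dot v w.
Proof. by rewrite /dot -big_split; apply: eq_bigr => m _; rewrite mxE mulrDl. Qed.

Lemma dotZl c u v : dot (c *: u) v = c * dot u v.
Proof. by rewrite /dot mulr_sumr; apply: eq_bigr => m _; rewrite mxE mulrA. Qed.

Lemma dotNl u v : dot (- u) v = - dot u v.
Proof. by rewrite -scaleN1r dotZl mulN1r. Qed.

Lemma dotBl u v w : dot (u - v) w = dot u w - dot v w.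
Proof. by rewrite dotDl dotNl. Qed.

Lemma dotDr u v w : dot w (u + v) = dot w u + dot w v.
Proof. by rewrite dotC dotDl !(dotC w). Qed.

Lemma dotZr c u v : dot v (c *: u) = c * dot v u.
Proof. by rewrite dotC dotZl dotC. Qed.

Lemma dotNr u v : dot v (- u) = - dot v u.
Proof. by rewrite dotC dotNl dotC. Qed.

Lemma dotBr u v w : dot w (u - v) = dot w u - dot w v.
Proof. by rewrite dotDr dotNr. Qed.

Lemma dot_suml (I : finType) (F : I -> 'rV[R]_d) v :
  dot (\sum_i F i) v = \sum_i dot (F i) v.
Proof.
by rewrite /dot exchange_big; apply: eq_bigr => m _; rewrite summxE mulr_suml.
Qed.

Lemma dot_sumr (I : finType) (F : I -> 'rV[R]_d) v :
  dot v (\sum_i F i) = \sum_i dot v (F i).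
Proof. by rewrite dotC dot_suml; apply: eq_bigr => i _; rewrite dotC. Qed.

Lemma dot_ge0 v : 0 <= dot v v.
Proof. by apply: sumr_ge0 => m _; rewrite -expr2 sqr_ge0. Qed.

Lemma fnorm_ge0 r s (M : 'M[R]_(r, s)) : 0 <= fnorm M.
Proof. exact: sqrtr_ge0. Qed.

Lemma fnorm_sqr v : fnorm v ^+ 2 = dot v v.
Proof.
rewrite /fnorm sqr_sqrtr big_ord1; first by apply: eq_bigr => m _; rewrite expr2.
by apply: sumr_ge0 => m _; rewrite sqr_ge0.
Qed.

Lemma fnormN v : fnorm (- v) = fnorm v.
Proof.
apply/eqP; rewrite -(@eqrXn2 _ 2) ?fnorm_ge0 //.
by rewrite !fnorm_sqr dotNl dotNr opprK.
Qed.

Lemma fnormBC u v : fnorm (u - v) = fnorm (v - u).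
Proof. by rewrite -fnormN opprB. Qed.

Lemma fnormZ c v : fnorm (c *: v) = `|c| * fnorm v.
Proof.
apply/eqP; rewrite -(@eqrXn2 _ 2) ?fnorm_ge0 ?mulr_ge0 ?fnorm_ge0 //.
by rewrite exprMn !fnorm_sqr dotZl dotZr real_normK ?num_real // mulrA expr2.
Qed.

Lemma fnorm_eq0 v : fnorm v = 0 -> v = 0.
Proof.
move=> v0; apply/rowP => m; rewrite mxE.
have /eqP := fnorm_sqr v; rewrite v0 expr0n /= eq_sym psumr_eq0; last first.
  by move=> j _; rewrite -expr2 sqr_ge0.
by move=> /allP/(_ m); rewrite mem_index_enum -expr2 sqrf_eq0 => /(_ isT)/eqP.
Qed.

(** Cauchy-Schwarz: expand the square of [fnorm v *: u - fnorm u *: v] and divide by the product of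
    the norms; zero vectors are treated apart. *)
Lemma dot_le_fnorm u v : dot u v <= fnorm u * fnorm v.
Proof.
have [v0|v0] := eqVneq (fnorm v) 0.
  by rewrite v0 mulr0 (fnorm_eq0 v0) -(scale0r 0) dotZr mul0r.
have vp : 0 < fnorm v by rewrite lt0r v0 fnorm_ge0.
have := dot_ge0 (fnorm v *: u - (fnorm u) *: v).
rewrite dotBl !dotBr !dotZl !dotZr -!fnorm_sqr (dotC v u) => H.
have [u0|u0] := eqVneq (fnorm u) 0.
  by rewrite u0 mul0r (fnorm_eq0 u0) -(scale0r 0) dotZl mul0r.
have up : 0 < fnorm u by rewrite lt0r u0 fnorm_ge0.
have : 0 <= (fnorm u * fnorm v) * (fnorm u * fnorm v - dot u v) by nra.
by rewrite pmulr_rge0 ?mulr_gt0 // subr_ge0.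
Qed.

Lemma ler_fnormD u v : fnorm (u + v) <= fnorm u + fnorm v.
Proof.
rewrite -(@ler_pXn2r _ 2) ?nnegrE ?addr_ge0 ?fnorm_ge0 //.
rewrite fnorm_sqr dotDl !dotDr (dotC v u) sqrrD !fnorm_sqr.
have := dot_le_fnorm u v; lra.
Qed.

(** The gap between the two sides is the variance [\sum_i a i * fnorm (F i - v) ^+ 2], where [v] is
    the weighted mean. *)
Lemma fnorm_sqr_convex (I : finType) (a : I -> R) (F : I -> 'rV[R]_d) :
  (forall i, 0 <= a i) -> \sum_i a i = 1 ->
  fnorm (\sum_i a i *: F i) ^+ 2 <= \sum_i a i * fnorm (F i) ^+ 2.
Proof.
move=> a0 a1; set v := \sum_i _.
have : 0 <= \sum_i a i * dot (F i - v) (F i - v).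
  by apply: sumr_ge0 => i _; rewrite mulr_ge0 ?dot_ge0.
under eq_bigr => i _.
  rewrite dotBl !dotBr (dotC v) opprB addrCA addrC !mulrDr !mulrN.
  rewrite -[a i * dot (F i) v]dotZl; over.
rewrite !big_split /= -mulr_suml a1 !sumrN -dot_suml -/v mul1r fnorm_sqr.
under [X in _ -> _ <= X]eq_bigr do rewrite fnorm_sqr.
lra.
Qed.

(** This is the limit [t -> 0]. It turns an inequality along a segment into a first-order
    condition. *)
Lemma first_order_le0 (c B : R) :
  (forall t, 0 < t <= 1 -> c <= t * B) -> c <= 0.
Proof.
move=> h; rewrite leNgt; apply/negP => c0.
have B0 : 0 < B by have := h 1; rewrite mul1r ltr01 lexx => /(_ isT); lra.
have Bc : 0 < 2 * B + c by lra.
(* This [t] lies in ]0, 1] and makes [t * B] smaller than [c], which contradicts [h]. *)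
have t01 : 0 < c / (2 * B + c) <= 1 by rewrite divr_gt0 //= ler_pdivrMr //; lra.
by have := h _ t01; rewrite mulrAC ler_pdivlMr //; nra.
Qed.

Lemma box_convex (l u : 'rV[R]_d) v w (t : R) : 0 <= t <= 1 ->
  box l u v -> box l u w -> box l u ((1 - t) *: v + t *: w).
Proof.
move=> t01 bv bw m; move: (bv m) (bw m); rewrite !mxE; nra.
Qed.

(** Moving from [p] towards [y] stays in the box, so minimality of [p] makes the angle at [p]
    between [v] and [y] obtuse; the expansion of |v - y|^2 around [p] then dominates |p - y|^2. *)
Lemma proj_box_le (l u : 'rV[R]_d) v p y : is_proj (box l u) v p ->
  box l u y -> fnorm (p - y) ^+ 2 <= fnorm (v - y) ^+ 2.
Proof.
move=> [bp hp] bY.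
have obtuse : 2 * dot (v - p) (y - p) <= 0.
  apply: (@first_order_le0 _ (dot (y - p) (y - p))) => t /andP[t0 t1].
  have := hp _ (@box_convex l u p y t _ bp bY).
  rewrite (ltW t0) t1 => /(_ isT).
  rewrite -(@ler_pXn2r _ 2) ?nnegrE ?fnorm_ge0 //.
  have -> : v - ((1 - t) *: p + t *: y) = (v - p) - t *: (y - p).
    by apply/rowP => m; rewrite !mxE; ring.
  rewrite !fnorm_sqr; move: (v - p) (y - p) => e e'.
  rewrite [X in _ <= X]dotBl !dotBr !dotZl !dotZr (dotC e' e) => h.
  have : 0 <= t * (t * dot e' e' - 2 * dot e e') by nra.
  by rewrite pmulr_rge0 // subr_ge0.
have -> : v - y = (v - p) - (y - p) by rewrite opprB addrA subrK.
rewrite (fnormBC p) !fnorm_sqr; move: (v - p) (y - p) obtuse => e e' obtuse.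
rewrite [X in _ <= X]dotBl !dotBr (dotC e' e).
have := dot_ge0 e; lra.
Qed.

End Euclidean.

(** * Spectral gap and consensus *)

(* The all-ones vector is fixed by A^T A, so it is the top right singular
   vector, because all the other singular values are at most sigma < 1. *)
Lemma mulmx_spectral_gap (R : realType) (n : nat) (A : 'M[R]_n) (sigma : R)
    (y : 'cV[R]_n) :
  doubly_stochastic A -> second_singular_value A sigma -> sigma < 1 ->
  \sum_i y i 0 = 0 ->
  \sum_i (A *m y) i 0 ^+ 2 <= sigma ^+ 2 * \sum_i y i 0 ^+ 2.
Proof.
have colsq (v : 'cV[R]_n) : \sum_i v i 0 ^+ 2 = (v^T *m v) 0 0.
  by rewrite mxE; apply: eq_bigr => i _; rewrite mxE expr2.
move=> [_ rows cols] [n1 [s [ss sorted_s s0 [U [V [UU VV AE]]]] sigmaE]] sigma1.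
move=> y0; set D := diag_mx _ in AE.
have {}UU : U^T *m U = 1%:M by apply: mulmx1C.
have VTV : V^T *m V = 1%:M by apply: mulmx1C.
have gram : A^T *m A = V *m (D *m D) *m V^T.
  rewrite AE !trmx_mul trmxK tr_diag_mx !mulmxA.
  by rewrite -(mulmxA _ U^T U) UU mulmx1.
pose e : 'cV[R]_n := const_mx 1.
(* [c] and [w] are the coordinates of the all-ones vector and of [y] in the basis of right singular
   vectors. *)
pose c := V^T *m e; pose w := V^T *m y.
have ge : A^T *m A *m e = e.
  have Ae : A *m e = e.
    apply/colP => i; rewrite !mxE -[RHS](rows i).
    by apply: eq_bigr => j _; rewrite mxE mulr1.
  rewrite -mulmxA Ae; apply/colP => i; rewrite !mxE -[RHS](cols i).
  by apply: eq_bigr => j _; rewrite !mxE mulr1.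
have cE (j : 'I_n) : s`_j ^+ 2 * c j 0 = c j 0.
  have : D *m D *m c = c.
    rewrite -[RHS]/(V^T *m e) -[in RHS]ge gram !mulmxA VTV mul1mx.
    by [].
  move/matrixP/(_ j 0); rewrite -mulmxA /D !mul_diag_mx; clearbody c.
  by rewrite !mxE mulrA -expr2.
have sle (j : 'I_n) : (0 < j)%N -> 0 <= s`_j <= sigma.
  move=> j0; rewrite (allP s0) ?mem_nth ?ss //=.
  rewrite sigmaE; apply: (sorted_leq_nth ge_trans ge_refl) => //.
  - by rewrite inE ss.
  - by rewrite inE ss.
(* For [j > 0] the singular value is below 1, so the fixed-point relation [cE] forces the coordinate
   to vanish. Only coordinate 0 of [c] survives, and it is nonzero because [V] is invertible. *)
have cj0 (j : 'I_n) : (0 < j)%N -> c j 0 = 0.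
  move=> /sle /andP[sj0 sj1].
  have /eqP := cE j; rewrite -subr_eq0 -{2}[c j 0]mul1r -mulrBl mulf_eq0.
  case/orP => /eqP // h.
  have : s`_j ^+ 2 < 1 by rewrite expr_lt1 // (le_lt_trans sj1).
  by rewrite -subr_lt0 h ltxx.
pose o : 'I_n := Ordinal (ltnW n1).
have c0 : c o 0 != 0.
  apply/eqP => h; have c00 : c = 0.
    apply/colP => j; rewrite [RHS]mxE; have [j0|/cj0 //] := posnP j.
    by rewrite -h; congr (c _ _); exact: val_inj.
  have : V *m c = 0 by rewrite c00 mulmx0.
  rewrite /c mulmxA VV mul1mx => /colP/(_ o); rewrite !mxE => /eqP.
  by rewrite oner_eq0.
(* Since [V] is orthogonal, the inner product of [c] and [w] is that of the all-ones vector and [y],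
   which is zero; it reduces to the product of the 0-th coordinates. *)
have w0 : w o 0 = 0.
  have : (c^T *m w) 0 0 = 0.
    rewrite /c /w trmx_mul trmxK mulmxA -(mulmxA _ V) VV mulmx1 mxE -[RHS]y0.
    by apply: eq_bigr => i _; rewrite !mxE mul1r.
  rewrite mxE (bigD1 o) //= big1 ?addr0 => [/eqP|j jo].
    by rewrite mxE mulf_eq0 (negPf c0) => /eqP.
  rewrite mxE cj0 ?mul0r // lt0n; apply: contraNneq jo => jo.
  by apply/eqP/val_inj.
have -> : \sum_i y i 0 ^+ 2 = \sum_i w i 0 ^+ 2.
  by rewrite !colsq /w trmx_mul trmxK !mulmxA -(mulmxA _ V) VV mulmx1.
have -> : \sum_i (A *m y) i 0 ^+ 2 = \sum_(i < n) (s`_i * w i 0) ^+ 2.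
  transitivity (\sum_i (D *m w) i 0 ^+ 2); last first.
    by apply: eq_bigr => i _; rewrite /D mul_diag_mx !mxE.
  rewrite !colsq trmx_mul !mulmxA -(mulmxA _ A^T) gram /w !trmx_mul trmxK.
  by rewrite tr_diag_mx !mulmxA.
rewrite mulr_sumr; apply: ler_sum => i _; rewrite exprMn.
have [i0|/sle /andP[si0 si1]] := posnP i.
  suff -> : w i 0 = 0 by rewrite expr0n !mulr0.
  by rewrite -w0; congr (w _ _); exact: val_inj.
by rewrite ler_wpM2r ?sqr_ge0 // ler_pXn2r // nnegrE // (le_trans si0).
Qed.

Section MeanDeviation.
Variables (R : realType) (n d : nat).
Implicit Types (F Z : 'I_n -> 'rV[R]_d).

Lemma sum_deviation F : \sum_i (F i - n%:R^-1 *: \sum_j F j) = 0.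
Proof.
case: n F => [|n'] F; first by rewrite big_ord0.
rewrite big_split /= sumrN sumr_const card_ord -scaler_nat scalerA.
by rewrite divff ?pnatr_eq0 // scale1r subrr.
Qed.

Lemma sum_fnorm_sqr_shift Z c : \sum_i Z i = 0 ->
  \sum_i fnorm (c + Z i) ^+ 2 = n%:R * fnorm c ^+ 2 + \sum_i fnorm (Z i) ^+ 2.
Proof.
move=> Z0; under eq_bigr do rewrite fnorm_sqr dotDl !dotDr.
rewrite !big_split /= -(dot_sumr Z c) -(dot_suml Z c) Z0 sumr_const card_ord.
rewrite -[in dot c 0](scale0r 0) -[in dot 0 c](scale0r 0) dotZr dotZl !mul0r.
rewrite addr0 add0r fnorm_sqr mulr_natl; congr (_ + _).
by apply: eq_bigr => i _; rewrite fnorm_sqr.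
Qed.

Lemma box_mean (l u : 'rV[R]_d) F : (0 < n)%N -> (forall i, box l u (F i)) ->
  box l u (n%:R^-1 *: \sum_i F i).
Proof.
move=> n0 hF m; have nR : 0 < n%:R :> R by rewrite ltr0n.
rewrite mxE summxE mulrC ler_pdivlMr // ler_pdivrMr //.
have cn (c : R) : c * n%:R = \sum_(i < n) c.
  by rewrite sumr_const card_ord mulr_natr.
by rewrite !cn; apply/andP; split; apply: ler_sum => i _; case/andP: (hF i m).
Qed.

Lemma fnorm_le_sum F i : fnorm (F i) <= Num.sqrt (\sum_j fnorm (F j) ^+ 2).
Proof.
rewrite -(@ler_pXn2r _ 2) ?nnegrE ?fnorm_ge0 ?sqrtr_ge0 // [X in _ <= X]sqr_sqrtr.
  by rewrite (bigD1 i) //= lerDl sumr_ge0 // => j _; rewrite sqr_ge0.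
by apply: sumr_ge0 => j _; rewrite sqr_ge0.
Qed.

(** The matrix acts on each coordinate [m] separately, so the scalar spectral gap applies to each
    column and the results are summed. *)
Lemma sum_fnorm_spectral_gap (A : 'M[R]_n) (sigma : R) Z :
  doubly_stochastic A -> second_singular_value A sigma -> sigma < 1 ->
  \sum_i Z i = 0 ->
  \sum_i fnorm (\sum_j A i j *: Z j) ^+ 2 <=
    sigma ^+ 2 * \sum_i fnorm (Z i) ^+ 2.
Proof.
move=> hA hs s1 Z0; under eq_bigr do rewrite fnorm_sqr.
under [X in _ <= _ * X]eq_bigr do rewrite fnorm_sqr.
rewrite exchange_big /= [X in _ <= _ * X]exchange_big /= mulr_sumr.
apply: ler_sum => m _.
have h0 : \sum_i (\col_i Z i 0 m) i 0 = 0 :> R.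
  under eq_bigr do rewrite mxE.
  by rewrite -summxE Z0 mxE.
have e1 i : (A *m \col_i Z i 0 m) i 0 = (\sum_j A i j *: Z j) 0 m.
  by rewrite mxE summxE; apply: eq_bigr => j _; rewrite !mxE.
rewrite (eq_bigr (fun i => (A *m \col_i Z i 0 m) i 0 ^+ 2)); last first.
  by move=> i _; rewrite e1 expr2.
rewrite [X in _ <= _ * X](eq_bigr (fun i => (\col_i Z i 0 m) i 0 ^+ 2)).
  exact: mulmx_spectral_gap.
by move=> i _; rewrite mxE expr2.
Qed.

End MeanDeviation.

(** * One step of the algorithm, for fixed states and quantized values *)

Section OneStep.
Variables (R : realType) (n d : nat) (l u xs : 'rV[R]_d).
Variables (f : 'I_n -> 'rV[R]_d -> R) (g : 'I_n -> 'rV[R]_d -> 'rV[R]_d).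
Variables (Li mui : 'I_n -> R) (mu : R) (A : 'M[R]_n) (sigma alpha beta : R).
Local Notation X := (box l u).
Local Notation L := (\sum_i Li i).
Hypotheses (hLi : forall i, 0 <= Li i)
  (hlip : forall i, lipschitz_bound_on X (Li i) (f i))
  (hgL : forall i y, X y -> fnorm (g i y) <= Li i)
  (hstrong : forall i, strongly_convex_on X (mui i) (f i) (g i))
  (hmu : forall i, mu <= mui i)
  (hxs : minimizer_on X (fun y => \sum_i f i y) xs).
Variable p : 'I_n -> 'rV[R]_d.
Hypothesis hp : forall i, X (p i).
Hypothesis n_gt0 : (0 < n)%N.

Local Notation pbar := (n%:R^-1 *: \sum_i p i).
Local Notation S := (\sum_i fnorm (p i - xs) ^+ 2).

Let strongly_convex_mu i x y : X x -> X y ->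
  mu / 2 * fnorm (y - x) ^+ 2 <= f i y - f i x - dot (g i x) (y - x).
Proof.
move=> hx hy; have := hstrong i hx hy; apply: le_trans.
by rewrite ler_wpM2r ?sqr_ge0 // ler_pM2r.
Qed.

(* Strong convexity is applied along the segments from xs to the p i; the
   minimality of xs is used at the points moving towards the mean. *)
Lemma sum_strong_growth :
  mu / 2 * S - \sum_i Li i * fnorm (p i - pbar) <=
    \sum_i f i (p i) - \sum_i f i xs.
Proof.
have [Xs min_xs] := hxs; have Xb := box_mean n_gt0 hp.
set W := \sum_i Li i * _.
suff : mu / 2 * S - W - (\sum_i f i (p i) - \sum_i f i xs) <= 0 by lra.
apply: (@first_order_le0 _ _ (mu / 2 * S)) => t /andP[t0 t1].
have t01 : 0 <= t <= 1 by rewrite (ltW t0) t1.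
suff : t * (mu / 2 * S - W - (\sum_i f i (p i) - \sum_i f i xs)
            - t * (mu / 2 * S)) <= 0.
  by rewrite pmulr_rle0 // subr_le0.
have hmin := min_xs _ (box_convex t01 Xs Xb).
(* All nodes are evaluated at one point moving from [xs] towards the mean, where minimality applies.
   It lies at distance [t * fnorm (p i - pbar)] from the point [z] of the segment of node [i],
   whence the Lipschitz cost [t * W]. *)
suff : \sum_i f i ((1 - t) *: xs + t *: pbar) <=
    (1 - t) * \sum_i f i xs + t * \sum_i f i (p i) + t * W
     - t * (1 - t) * (mu / 2 * S).
  by move: hmin; set F := \sum_i f i (_ + _); lra.
rewrite /W !mulr_sumr -!big_split /= -sumrB; apply: ler_sum => i _.
set z := (1 - t) *: xs + t *: p i; have Xz : X z by exact: box_convex.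
have e1 : xs - z = - t *: (p i - xs) by apply/rowP => m; rewrite !mxE; ring.
have e2 : p i - z = (1 - t) *: (p i - xs).
  by apply/rowP => m; rewrite !mxE; ring.
have := strongly_convex_mu i Xz Xs; have := strongly_convex_mu i Xz (hp i).
rewrite e1 e2 !fnormZ !dotZr !exprMn !real_normK ?num_real //.
have := hlip i (box_convex t01 Xs Xb) Xz.
have -> : (1 - t) *: xs + t *: pbar - z = t *: (pbar - p i).
  by apply/rowP => m; rewrite !mxE; ring.
rewrite fnormZ (ger0_norm (ltW t0)) (fnormBC _ (p i)) => /ler_normlW.
(* The strong convexity inequalities at [z] towards [p i] and [xs], with weights [t] and [1 - t],
   are added: the subgradient terms cancel and the quadratic ones give [t * (1 - t)]. *)
clearbody z; move: (f i z) (f i xs) (f i (p i)) (f i (_ + _)) (fnorm (p i - xs)).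
move: (fnorm (p i - _)) (dot _ _).
move=> Y G fz fs fp fb D h1.
have t1' : 0 <= 1 - t by rewrite subr_ge0.
by move=> /(ler_wpM2l (ltW t0)) h2 /(ler_wpM2l t1') h3; lra.
Qed.

Hypotheses (hA : doubly_stochastic A) (hs : second_singular_value A sigma).
Hypotheses (hsigma : 0 <= sigma <= 3 / 8) (alpha_ge0 : 0 <= alpha)
  (hbeta : 0 < beta <= 1).

Local Notation dev := (fun i => p i - pbar).
Local Notation V := (\sum_i fnorm (p i - pbar) ^+ 2).
Local Notation mix :=
  (fun i => (1 - beta) *: p i + beta *: \sum_j A i j *: p j).

Let sigma_ge0 : 0 <= sigma. Proof. by case/andP: hsigma. Qed.
Let sigma_le : sigma <= 3 / 8. Proof. by case/andP: hsigma. Qed.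
Let sigma1 : sigma < 1. Proof. by move: sigma_le; lra. Qed.
Let beta_gt0 : 0 < beta. Proof. by case/andP: hbeta. Qed.
Let beta_le1 : beta <= 1. Proof. by case/andP: hbeta. Qed.

Lemma mix_deviation i :
  \sum_j A i j *: p j = pbar + \sum_j A i j *: (p j - pbar).
Proof.
case: hA => _ rows _; under [X in _ = _ + X]eq_bigr do rewrite scalerBr.
by rewrite sumrB -scaler_suml rows scale1r addrC subrK.
Qed.

(** [S] splits into a mean part and the deviation part [V]. Averaging with [A] preserves the mean
    and contracts [V] by sigma^2 <= sigma; convexity of the square handles the weights [1 - beta]
    and [beta]. *)
Lemma sum_mix_le :
  \sum_i fnorm (mix i - xs) ^+ 2 <= S - beta * (1 - sigma) * V.
Proof.
have dev0 := sum_deviation p.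
have SE : S = n%:R * fnorm (pbar - xs) ^+ 2 + V.
  rewrite -(sum_fnorm_sqr_shift (pbar - xs) dev0).
  by apply: eq_bigr => i _; congr (fnorm _ ^+ 2); rewrite [RHS]addrC addrA subrK.
have AE : \sum_i fnorm (\sum_j A i j *: p j - xs) ^+ 2 <=
    n%:R * fnorm (pbar - xs) ^+ 2 + sigma ^+ 2 * V.
  apply: (@le_trans _ _
    (n%:R * fnorm (pbar - xs) ^+ 2 +
     \sum_i fnorm (\sum_j A i j *: (p j - pbar)) ^+ 2)).
    rewrite -sum_fnorm_sqr_shift; last first.
      rewrite exchange_big /=; under eq_bigr do rewrite -scaler_suml.
      by case: hA => _ _ cols; under eq_bigr do rewrite cols scale1r.
    by under eq_bigr do rewrite mix_deviation addrAC.
  by rewrite lerD2l; exact: sum_fnorm_spectral_gap.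
have : \sum_i fnorm (mix i - xs) ^+ 2 <=
    (1 - beta) * S + beta * \sum_i fnorm (\sum_j A i j *: p j - xs) ^+ 2.
  rewrite !mulr_sumr -big_split; apply: ler_sum => i _ /=.
  have -> : mix i - xs = (1 - beta) *: (p i - xs)
      + beta *: (\sum_j A i j *: p j - xs).
    by apply/rowP => m; rewrite !mxE; ring.
  rewrite !fnorm_sqr; move: (p i - xs) (\sum_j _ - xs) => v w.
  have bb : 0 <= beta * (1 - beta) by rewrite mulr_ge0 ?subr_ge0 // ltW.
  have := mulr_ge0 bb (dot_ge0 (v - w)).
  rewrite dotBl !dotBr [dot (_ + _) _]dotDl !dotDr !dotZl !dotZr (dotC w v).
  lra.
have V0 : 0 <= V by apply: sumr_ge0 => i _; rewrite sqr_ge0.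
have sV : sigma ^+ 2 * V <= sigma * V.
  by rewrite ler_wpM2r // expr2 ler_piMl // ltW.
rewrite SE.
have := ler_wpM2l (ltW beta_gt0) AE; have := ler_wpM2l (ltW beta_gt0) sV.
lra.
Qed.
Lemma sum_weighted_deviation_le : \sum_i Li i * fnorm (dev i) <= L * Num.sqrt V.
Proof.
rewrite mulr_suml; apply: ler_sum => i _; rewrite ler_wpM2l //.
exact: (fnorm_le_sum dev).
Qed.

Lemma sum_weighted_mix_deviation_le :
  \sum_i Li i * fnorm (\sum_j A i j *: dev j) <= L * (sigma * Num.sqrt V).
Proof.
rewrite mulr_suml; apply: ler_sum => i _; rewrite ler_wpM2l //.
apply: le_trans (fnorm_le_sum (fun i => \sum_j A i j *: dev j) i) _.
rewrite -[sigma](ger0_norm sigma_ge0) -sqrtr_sqr -sqrtrM ?sqr_ge0 // ler_wsqrtr //.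
by apply: sum_fnorm_spectral_gap => //; exact: sum_deviation.
Qed.

Variables q p' : 'I_n -> 'rV[R]_d.
Hypothesis hp' : forall i, is_proj X
  ((1 - beta) *: p i + beta *: (\sum_j A i j *: q j) - alpha *: g i (p i))
  (p' i).
Local Notation noise := (fun i => \sum_j A i j *: (q j - p j)).

(** After the projection inequality, the square of [(m - xs) + beta *: N - alpha *: gi] is expanded.
    The subgradient product with [xs - m] is split at [p i]: strong convexity controls [xs - p i],
    while [p i - m] is [beta] times a difference of deviations. The product with [N] is bounded by
    Cauchy-Schwarz. *)
Lemma node_step_le i :
  fnorm (p' i - xs) ^+ 2 <= fnorm (mix i - xs) ^+ 2
    + (2 * beta * dot (mix i - xs) (noise i) + beta ^+ 2 * fnorm (noise i) ^+ 2
       + 2 * alpha * beta * Li i * fnorm (noise i))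
    + 2 * alpha * (f i xs - f i (p i) - mu / 2 * fnorm (p i - xs) ^+ 2
       + beta * Li i * (fnorm (dev i) + fnorm (\sum_j A i j *: dev j)))
    + alpha ^+ 2 * Li i ^+ 2.
Proof.
have [Xs _] := hxs; apply: le_trans (proj_box_le (hp' i) Xs) _.
have b0 := ltW beta_gt0.
set gi := g i (p i); set N := noise i; set m := mix i.
have -> : (1 - beta) *: p i + beta *: (\sum_j A i j *: q j) - alpha *: gi - xs
    = (m - xs) + beta *: N - alpha *: gi.
  rewrite /m /N; under [X in _ = _ + _ *: X - _]eq_bigr do rewrite scalerBr.
  by rewrite sumrB; apply/rowP => k; rewrite !mxE; ring.
have gL : fnorm gi <= Li i by exact: hgL.
have hpm : p i - m = beta *: (dev i - \sum_j A i j *: dev j).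
  by rewrite /m mix_deviation; apply/rowP => k; rewrite !mxE; ring.
have h1 : dot gi (xs - m) <= f i xs - f i (p i) - mu / 2 * fnorm (p i - xs) ^+ 2
    + beta * Li i * (fnorm (dev i) + fnorm (\sum_j A i j *: dev j)).
  have -> : xs - m = (xs - p i) + (p i - m) by rewrite addrA subrK.
  rewrite dotDr; apply: lerD.
    have := strongly_convex_mu i (hp i) Xs.
    by rewrite (fnormBC xs) -/gi; lra.
  rewrite hpm dotZr -mulrA ler_wpM2l //; apply: le_trans (dot_le_fnorm _ _) _.
  apply: ler_pM; rewrite ?fnorm_ge0 //.
  by apply: le_trans (ler_fnormD _ _) _; rewrite fnormN.
have h2 : - dot gi N <= Li i * fnorm N.
  rewrite -dotNl; apply: le_trans (dot_le_fnorm _ _) _.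
  by rewrite fnormN ler_wpM2r ?fnorm_ge0.
have h3 : fnorm gi ^+ 2 <= Li i ^+ 2 by rewrite ler_pXn2r ?nnegrE ?fnorm_ge0.
have expand v w z : fnorm (v + beta *: w - alpha *: z) ^+ 2 =
    fnorm v ^+ 2 + 2 * beta * dot v w + beta ^+ 2 * fnorm w ^+ 2
    + 2 * alpha * dot z (- v) + 2 * alpha * beta * (- dot z w)
    + alpha ^+ 2 * fnorm z ^+ 2.
  rewrite !fnorm_sqr !(dotDl, dotDr, dotNl, dotNr, dotZl, dotZr).
  by rewrite (dotC w v) (dotC z v) (dotC z w); ring.
rewrite expand opprB.
have H1 := ler_wpM2l alpha_ge0 h1.
have H2 := ler_wpM2l (mulr_ge0 alpha_ge0 b0) h2.
have H3 := ler_wpM2l (sqr_ge0 alpha) h3.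
lra.
Qed.

(* 2 (19/8) alpha L y - beta (1 - sigma) y^2 is at most
   6 (alpha L)^2 / (beta (1 - sigma)), since (19/8)^2 <= 6. *)
Lemma step_le :
  \sum_i fnorm (p' i - xs) ^+ 2 <= (1 - 2 * alpha * mu) * S
    + 6 * alpha ^+ 2 * L ^+ 2 / (beta * (1 - sigma)) + alpha ^+ 2 * L ^+ 2
    + \sum_i (2 * beta * dot (mix i - xs) (noise i)
       + beta ^+ 2 * fnorm (noise i) ^+ 2
       + 2 * alpha * beta * Li i * fnorm (noise i)).
Proof.
apply: le_trans (ler_sum _ (fun i _ => node_step_le i)) _.
rewrite big_split big_split big_split /= -!mulr_sumr.
set T := \sum_i (_ + _ + _).
have -> : \sum_i (f i xs - f i (p i) - mu / 2 * fnorm (p i - xs) ^+ 2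
      + beta * Li i * (fnorm (dev i) + fnorm (\sum_j A i j *: dev j)))
    = \sum_i f i xs - \sum_i f i (p i) - mu / 2 * S
      + beta * (\sum_i Li i * fnorm (dev i)
        + \sum_i Li i * fnorm (\sum_j A i j *: dev j)).
  rewrite big_split sumrB sumrB mulr_sumr -big_split mulr_sumr; congr (_ + _).
  by apply: eq_bigr => i _ /=; rewrite -mulrDr mulrA.
have L0 : 0 <= L by exact: sumr_ge0.
have LL : \sum_i Li i ^+ 2 <= L ^+ 2.
  rewrite expr2 mulr_suml; apply: ler_sum => i _; rewrite expr2 ler_wpM2l //.
  by rewrite (bigD1 i) //= lerDl sumr_ge0.
have := sum_strong_growth; have := sum_mix_le.
have := sum_weighted_deviation_le; have := sum_weighted_mix_deviation_le.
move: LL; set y := Num.sqrt V.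
have yV : y ^+ 2 = V by rewrite sqr_sqrtr // sumr_ge0 // => i _; rewrite sqr_ge0.
have y0 : 0 <= y by exact: sqrtr_ge0.
rewrite -yV.
set W1 := \sum_i Li i * fnorm (dev i).
set W2 := \sum_i Li i * fnorm (\sum_j A i j *: dev j).
set M := \sum_i fnorm (mix i - xs) ^+ 2.
set F0 := \sum_i f i xs; set F1 := \sum_i f i (p i).
move=> LL W2le W1le Mle Fle.
have bs0 : 0 < beta * (1 - sigma) by rewrite mulr_gt0 // subr_gt0.
have young : 2 * alpha * (L * y + beta * (L * y + L * (sigma * y)))
    - beta * (1 - sigma) * y ^+ 2
    <= 6 * alpha ^+ 2 * L ^+ 2 / (beta * (1 - sigma)).
  rewrite ler_pdivlMr //; set e := beta * (1 - sigma).
  have : 0 <= alpha * L * y * e.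
    by rewrite mulr_ge0 ?(ltW bs0) // mulr_ge0 // mulr_ge0.
  (* Here [beta <= 1] and [sigma <= 3 / 8]; adding the 1 from the growth estimate gives 19/8. *)
  have c0 : beta * (1 + sigma) <= 11 / 8.
    apply: (@le_trans _ _ (1 * (1 + sigma))); last by move: sigma_le; lra.
    by rewrite ler_wpM2r // addr_ge0.
  move=> h; have := ler_wpM2r h c0.
  have := sqr_ge0 (e * y - 19 / 8 * (alpha * L)).
  have := sqr_ge0 (alpha * L).
  lra.
have h1 := ler_wpM2l alpha_ge0 Fle.
have h2 := ler_wpM2l alpha_ge0 W1le.
have h3 := ler_wpM2l (mulr_ge0 alpha_ge0 (ltW beta_gt0)) W1le.
have h4 := ler_wpM2l (mulr_ge0 alpha_ge0 (ltW beta_gt0)) W2le.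
have h5 := ler_wpM2l (sqr_ge0 alpha) LL.
lra.
Qed.

End OneStep.

(** * Expectation of almost surely bounded functions *)

Section BoundedExpectation.
Context (disp : measure_display) (T : measurableType disp) (R : realType).
Variable P : probability T R.
Implicit Types (f g h : T -> R).

(** Boundedness is only almost sure because the quantized values are known through their law: they
    lie on the grid up to a null set. *)
Definition ae_bounded f : Prop :=
  measurable_fun [set: T] f /\ exists M, \forall w \ae P, `|f w| <= M.

Lemma ae_bounded_pt f M : measurable_fun [set: T] f ->
  (forall w, `|f w| <= M) -> ae_bounded f.
Proof. by move=> mf fM; split=> //; exists M; exact: aeW. Qed.

Lemma ae_bounded_cst c : ae_bounded (fun=> c).
Proof. by apply: (@ae_bounded_pt _ `|c|). Qed.

Lemma ae_boundedD f g : ae_bounded f -> ae_bounded g ->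
  ae_bounded (fun w => f w + g w).
Proof.
move=> [mf [M fM]] [mg [N gN]]; split; first exact: measurable_funD.
exists (M + N); near=> w; apply: le_trans (ler_normD _ _) _.
by apply: lerD; near: w.
Unshelve. all: by end_near. Qed.

Lemma ae_boundedM f g : ae_bounded f -> ae_bounded g ->
  ae_bounded (fun w => f w * g w).
Proof.
move=> [mf [M fM]] [mg [N gN]]; split; first exact: measurable_funM.
exists (M * N); near=> w; rewrite normrM.
by apply: ler_pM => //; near: w.
Unshelve. all: by end_near. Qed.

Lemma ae_boundedX f k : ae_bounded f -> ae_bounded (fun w => f w ^+ k).
Proof.
move=> bf; elim: k => [|k IH]; first exact: ae_bounded_cst.
by under eq_fun do rewrite exprS; exact: ae_boundedM.
Qed.

Lemma ae_boundedZ c f : ae_bounded f -> ae_bounded (fun w => c * f w).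
Proof. by apply: ae_boundedM; exact: ae_bounded_cst. Qed.

Lemma ae_boundedB f g : ae_bounded f -> ae_bounded g ->
  ae_bounded (fun w => f w - g w).
Proof.
move=> bf bg; apply: ae_boundedD => //.
by under eq_fun do rewrite -mulN1r; exact: ae_boundedZ.
Qed.

Lemma ae_bounded_sum (I : finType) (F : I -> T -> R) :
  (forall i, ae_bounded (F i)) -> ae_bounded (fun w => \sum_i F i w).
Proof.
move=> bF; have -> : (fun w => \sum_i F i w) = \sum_i F i.
  by apply/funext => w; rewrite fct_sumE.
apply: (big_ind ae_bounded) => //; first exact: ae_bounded_cst.
by move=> f g; exact: ae_boundedD.
Qed.

Lemma ae_bounded_integrable f : ae_bounded f ->
  P.-integrable [set: T] (EFin \o f).
Proof.
move=> [mf [M fM]]; apply/integrableP; split; first exact/measurable_EFinP.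
apply: (@le_lt_trans _ _ (\int[P]_w `|M|%:E)%E).
  apply: ae_ge0_le_integral => //.
  - by apply: measurableT_comp => //; exact/measurable_EFinP.
  - near=> w => _ /=; rewrite lee_fin; apply: le_trans (ler_norm M).
    by near: w.
by rewrite integral_cst //= probability_setT mule1 ltry.
Unshelve. all: by end_near. Qed.

Lemma ExpD f g : ae_bounded f -> ae_bounded g ->
  \int[P]_w (f w + g w) = \int[P]_w f w + \int[P]_w g w.
Proof. by move=> bf bg; apply: RintegralD => //; exact: ae_bounded_integrable. Qed.

Lemma ExpB f g : ae_bounded f -> ae_bounded g ->
  \int[P]_w (f w - g w) = \int[P]_w f w - \int[P]_w g w.
Proof. by move=> bf bg; apply: RintegralB => //; exact: ae_bounded_integrable. Qed.

Lemma ExpZ c f : ae_bounded f -> \int[P]_w (c * f w) = c * \int[P]_w f w.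
Proof. by move=> bf; apply: RintegralZl => //; exact: ae_bounded_integrable. Qed.

Lemma Exp_cst c : \int[P]_w c = c.
Proof. by rewrite Rintegral_cst //= probability_setT mulr1. Qed.

Lemma Exp_sum (I : finType) (F : I -> T -> R) :
  (forall i, ae_bounded (F i)) ->
  \int[P]_w (\sum_i F i w) = \sum_i \int[P]_w F i w.
Proof.
(* Boundedness is carried along with the value of the expectation through the induction on the
   sum. *)
move=> bF; pose K f c := ae_bounded f /\ \int[P]_w f w = c.
suff [] : K (fun w => \sum_i F i w) (\sum_i \int[P]_w F i w) by [].
have -> : (fun w => \sum_i F i w) = \sum_i F i.
  by apply/funext => w; rewrite fct_sumE.
apply: (big_ind2 K) => //.
- by split; [exact: ae_bounded_cst|exact: Exp_cst].
- move=> f c g c' [bf <-] [bg <-]; split; first exact: ae_boundedD.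
  exact: ExpD.
Qed.

Lemma le_Exp f g : ae_bounded f -> ae_bounded g -> (forall w, f w <= g w) ->
  \int[P]_w f w <= \int[P]_w g w.
Proof.
by move=> bf bg fg; apply: le_Rintegral => //; exact: ae_bounded_integrable.
Qed.

Lemma ae_bounded_indic (A : set T) : measurable A -> ae_bounded (\1_A : T -> R).
Proof.
move=> mA; apply: (@ae_bounded_pt _ 1); first exact: measurable_indic.
by move=> w; rewrite indicE; case: (_ \in _); rewrite ?normr1 ?normr0.
Qed.

Lemma Exp_indic (A : set T) : measurable A -> \int[P]_w \1_A w = fine (P A).
Proof. by move=> mA; rewrite /Rintegral integral_indic // setIT. Qed.

Lemma ae_eq_Exp f g : ae_bounded f -> ae_bounded g ->
  (\forall w \ae P, f w = g w) -> \int[P]_w f w = \int[P]_w g w.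
Proof.
move=> [mf _] [mg _] fg; congr fine; apply: ae_eq_integral => //.
- exact/measurable_EFinP.
- exact/measurable_EFinP.
- by apply: filterS fg => w /= ->.
Qed.

Lemma Exp_ge0_eq0 f : ae_bounded f -> (forall w, 0 <= f w) ->
  \int[P]_w f w = 0 -> \forall w \ae P, f w = 0.
Proof.
move=> bf f0 f_eq0; have mf : measurable_fun setT (EFin \o f).
  by apply/measurable_EFinP; case: bf.
have /(ae_eq_integral_abs P measurableT mf) : (\int[P]_w `|(EFin \o f) w| = 0)%E.
  under eq_integral do rewrite gee0_abs ?lee_fin //.
  rewrite -[LHS]fineK; first by congr (_%:E); exact: f_eq0.
  exact/integrable_fin_num/ae_bounded_integrable.
by apply: filterS => w /(_ I) [].
Qed.

End BoundedExpectation.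

(** * Random quantization *)

(** The sum counts the levels [c, 2 c, ..., n c] that [y] reaches, so it is the integer part of
    [y / c]. *)
Lemma layer_count (R : realType) (n : nat) (c y : R) : 0 < c ->
  0 <= y <= n%:R * c ->
  `|y - c * \sum_(j < n) (j.+1%:R * c <= y)%R%:R| <= c.
Proof.
move=> c0 /andP[y0 yn].
(* The upper bound on [y] is only claimed for [k < n], which lets the induction on [n] run without
   an upper bound on [y]; for [k = n] the hypothesis [yn] supplies it. *)
suff [k [kn -> ky yk]] : exists k : nat, [/\ (k <= n)%N,
    \sum_(j < n) (j.+1%:R * c <= y)%R%:R = k%:R :> R, k%:R * c <= y
    & (k < n)%N -> y <= k.+1%:R * c].
  have {}yk : y <= k.+1%:R * c.
    move: kn; rewrite leq_eqVlt => /predU1P[->|/yk //].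
    by apply: (le_trans yn); rewrite ler_pM2r // ler_nat.
  by move: yk; rewrite -natr1 => yk; rewrite ger0_norm; lra.
elim: n {yn} => [|n [k [kn e ky yk]]].
  by exists 0%N; split=> //; rewrite ?big_ord0 ?mul0r.
have [yn|yn] := leP (n.+1%:R * c) y.
  have kn' : k = n.
    apply/eqP; rewrite eqn_leq kn leqNgt; apply/negP => kn'.
    have := le_trans yn (yk kn'); rewrite ler_pM2r // ler_nat ltnS.
    by move=> /(leq_trans kn'); rewrite ltnn.
  exists n.+1; split; rewrite ?ltnn //.
  by rewrite big_ord_recr /= e kn' yn natr1.
exists k; split=> //; first exact: leqW.
  by rewrite big_ord_recr /= e leNgt yn addr0.
by rewrite ltnS leq_eqVlt => /predU1P[->|/yk //]; exact: ltW.
Qed.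

Section Quantizer.
Variables (R : realType) (lo Delta : R) (N : nat).
Hypothesis Delta_gt0 : 0 < Delta.
Local Notation tau s := (lo + s%:R * Delta).

(** The tent function of half-width [Delta] centred at the [s]-th grid point; at [x] it is the
    probability that [x] is rounded to that point. *)
Definition hat (s : nat) (x : R) : R :=
  Num.max 0 (1 - `|x - (lo + s%:R * Delta)| / Delta).

Lemma hat_shift (s : nat) (r : R) :
  hat s (lo + r * Delta) = Num.max 0 (1 - `|r - s%:R|).
Proof.
rewrite /hat; congr (Num.max _ (1 - _)).
rewrite -[X in _ / X](gtr0_norm Delta_gt0) -normf_div.
by congr `|_|; field; exact: lt0r_neq0.
Qed.

Lemma quant_law_atom (s : nat) (x : R) :
  quant_law lo Delta x [set tau s] = (hat s x)%:E.
Proof.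
rewrite /quant_law; set s0 := grid_index lo Delta x.
set p := (x - grid_point lo Delta s0) / Delta.
have xE : x = lo + (s0%:~R + p) * Delta.
  by rewrite /p /grid_point mulrDl divfK ?gt_eqF //; ring.
have fl : s0%:~R <= (x - lo) / Delta < (s0 + 1)%:~R by exact: floor_itv.
have xlo : (x - lo) / Delta = s0%:~R + p by rewrite xE addrC addKr mulfK ?gt_eqF.
move: fl; rewrite xlo intrD => /andP[]; rewrite lerDl ltrD2l => p0 p1.
have atom (t : int) :
    (\d_(grid_point lo Delta t) [set tau s] : \bar R) = (t == s)%:R%:E.
  rewrite diracE; congr ((nat_of_bool _)%:R)%:E; apply/idP/eqP.
    rewrite inE /grid_point /= => /addrI/(mulIf (lt0r_neq0 Delta_gt0))/eqP.
    by rewrite -[s%:R]/(s%:~R) eqr_int => /eqP.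
  by move=> ->; rewrite inE.
rewrite !atom -!EFinM -EFinD; congr _%:E.
rewrite xE hat_shift.
have -> : s0%:~R + p - s%:R = (s0 - s%:Z)%:~R + p by rewrite intrB; ring.
(* With [x] at relative position [p] in cell [s0], the grid point [s] is the left end, the right
   end, or at least one step away, where both sides vanish. *)
have [->|s0s] := eqVneq s0 s.
  rewrite subrr add0r ger0_norm // max_r ?subr_ge0 ?ltW //.
  have -> : (s%:Z + 1 == s) = false by apply/eqP; lia.
  by rewrite mulr1 mulr0 addr0.
have [e|s1s] := eqVneq (s0 + 1) s.
  have -> : s0 - s%:Z = -1 by rewrite -e; ring.
  rewrite mulr0 add0r mulr1 ler0_norm; last by rewrite mulrN1z; lra.
  by rewrite max_r mulrN1z; lra.
rewrite !mulr0 addr0 max_l // subr_le0.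
have [h|h] : (0 < s0 - s%:Z) \/ (s0 - s%:Z < -1) by lia.
  have : 1 <= (s0 - s%:Z)%:~R :> R by rewrite ler1z.
  by move=> h1; rewrite ger0_norm; lra.
have : (s0 - s%:Z)%:~R <= (-2)%:~R :> R by rewrite ler_int; lia.
by rewrite mulrNz => h1; rewrite ler0_norm; lra.
Qed.

(** [p = 1] is allowed, so that the right endpoint belongs to the last cell instead of opening one
    beyond the grid. A grid with [N = 0] has no cell. *)
Lemma grid_cell (x : R) : lo <= x <= tau N ->
  x = lo /\ N = 0%N \/ exists s p,
  [/\ (s < N)%N, 0 <= p <= 1 & x = lo + (s%:R + p) * Delta].
Proof.
elim: N => [|M IH] /andP[h1 h2].
  by left; split=> //; move: h2; rewrite mul0r; lra.
right; have [xM|xM] := leP x (tau M).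
  have [[-> _]|[s [p [sM p01 xE]]]] := IH (introT andP (conj h1 xM)).
    by exists 0%N, 0; rewrite lexx ler01 add0r mul0r addr0.
  by exists s, p; split=> //; exact: leqW.
exists M, ((x - tau M) / Delta); split=> //.
  apply/andP; split; first by rewrite divr_ge0 ?subr_ge0 // ltW.
  by rewrite ler_pdivrMr // mul1r; move: h2; rewrite -natr1; lra.
by rewrite mulrDl divfK ?gt_eqF //; ring.
Qed.

Lemma hat_cell (s s' : nat) (p : R) : 0 <= p <= 1 ->
  hat s' (lo + (s%:R + p) * Delta) =
    (1 - p) * (s' == s)%:R + p * (s' == s.+1)%:R.
Proof.
move=> /andP[p0 p1]; rewrite hat_shift.
have [->|s's] := eqVneq s' s.
  have -> : (s == s.+1) = false by apply/eqP; lia.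
  by rewrite addrAC subrr add0r mulr0 addr0 mulr1 ger0_norm // max_r ?subr_ge0.
have [->|s's1] := eqVneq s' s.+1.
  rewrite mulr0 add0r mulr1 -natr1.
  by rewrite ler0_norm ?max_r; lra.
rewrite !mulr0 addr0 max_l // subr_le0.
have [h|h] : (s'.+1 <= s)%N \/ (s.+2 <= s')%N by lia.
  have : s'.+1%:R <= s%:R :> R by rewrite ler_nat.
  by rewrite -natr1 => h1; rewrite ger0_norm; lra.
have : s.+2%:R <= s'%:R :> R by rewrite ler_nat.
by rewrite -!natr1 => h1; rewrite ler0_norm; lra.
Qed.

(* The mean of phi under the quantization law of x. *)
Definition hat_mean (phi : R -> R) (x : R) : R :=
  \sum_(s < N.+1) phi (tau s) * hat s x.

(** Only the tents at the two ends of the cell are nonzero there, so [hat_mean] interpolates [phi]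
    linearly between grid points. *)
Lemma hat_meanE phi s p : (s < N)%N -> 0 <= p <= 1 ->
  hat_mean phi (lo + (s%:R + p) * Delta) =
    (1 - p) * phi (tau s) + p * phi (tau s.+1).
Proof.
move=> sN p01; rewrite /hat_mean.
under eq_bigr do rewrite hat_cell //.
have s1 : (s < N.+1)%N by exact: ltnW.
rewrite (bigD1 (Ordinal s1)) //= (bigD1 (Ordinal (sN : (s.+1 < N.+1)%N))) /=.
  rewrite !eqxx (gtn_eqF (ltnSn s)) (ltn_eqF (ltnSn s)) big1.
    by rewrite !(mulr0, mulr1, addr0, add0r) !(mulrC (phi _)).
  move=> i /andP[i1 i2]; rewrite -!val_eqE /= in i1 i2.
  by rewrite (negPf i1) (negPf i2) !mulr0 addr0 mulr0.
by rewrite -val_eqE /= (gtn_eqF (ltnSn s)).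
Qed.

End Quantizer.
Section QuantizerMoments.
Variables (R : realType) (lo Delta : R) (N : nat) (x : R).
Hypotheses (Delta_gt0 : 0 < Delta) (hx : lo <= x <= lo + N%:R * Delta).

Let tau0 : lo = lo + (0%:R + 0) * Delta.
Proof. by rewrite addr0 mul0r addr0. Qed.

Lemma hat_mean_degenerate phi : N = 0%N -> hat_mean lo Delta N phi lo = phi lo.
Proof.
move=> ->; rewrite /hat_mean big_ord1 {3}tau0 hat_cell ?lexx ?ler01 //=.
by rewrite subr0 mul1r !mul0r !addr0 mulr1.
Qed.

Lemma hat_mean_cst : hat_mean lo Delta N (fun=> 1) x = 1.
Proof.
have [[-> N0]|[s [p [sN p01 ->]]]] := grid_cell Delta_gt0 hx.
  by rewrite hat_mean_degenerate.
by rewrite hat_meanE //= !mulr1 subrK.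
Qed.

Lemma hat_mean_id : hat_mean lo Delta N id x = x.
Proof.
have [[-> N0]|[s [p [sN p01 ->]]]] := grid_cell Delta_gt0 hx.
  by rewrite hat_mean_degenerate.
by rewrite hat_meanE // -natr1; ring.
Qed.

(** The excess over [x ^+ 2] is the variance p (1 - p) Delta^2 <= Delta^2 / 4. The minimum covers
    [N = 0], where the variance is 0, and makes the bound comparable both to the spacing and to the
    length of the interval. *)
Lemma hat_mean_sqr :
  hat_mean lo Delta N (fun y => y ^+ 2) x <=
    x ^+ 2 + Num.min Delta (N%:R * Delta) ^+ 2 / 4.
Proof.
have [[-> N0]|[s [p [sN p01 ->]]]] := grid_cell Delta_gt0 hx.
  by rewrite hat_mean_degenerate // lerDl divr_ge0 ?sqr_ge0.
rewrite hat_meanE // min_l; last first.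
  by rewrite ler_peMl ?(ltW Delta_gt0) // ler1n (leq_ltn_trans _ sN).
rewrite -natr1; have := sqr_ge0 ((2 * p - 1) * Delta); lra.
Qed.

End QuantizerMoments.

(** * Moments of the quantization error given the history *)

Section ConditionalQuantization.
Context (disp : measure_display) (T : measurableType disp) (R : realType).
Variables (P : probability T R) (H : set (set T)).
Hypotheses (measurable_H : forall A, H A -> measurable A) (H_setT : H setT).

(* h is approximated within c by c * sum_j 1_{h >= (j + 1) c}. *)
Lemma Exp_mul_eq0 (h G : T -> R) (M : R) :
  ae_bounded P G -> (forall w, 0 <= h w <= M) ->
  (forall B, measurable B -> H (h @^-1` B)) ->
  (forall A, H A -> \int[P]_w (\1_A w * G w) = 0) ->
  \int[P]_w (h w * G w) = 0.
Proof.
move=> bG hM Hh HG.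
have mh : measurable_fun setT h.
  by move=> _ B mB; rewrite setTI; exact/measurable_H/Hh.
have bh : ae_bounded P h.
  apply: (@ae_bounded_pt _ _ _ P _ M) => // w.
  by case/andP: (hM w) => h0 h1; rewrite ger0_norm.
have bnG : ae_bounded P (fun w => `|G w|).
  case: bG => mG [K GK]; split; first exact: measurableT_comp.
  by exists K; apply: filterS GK => w; rewrite normr_id.
set e := \int[P]_w _; set a := \int[P]_w `|G w|.
have a0 : 0 <= a by apply: Rintegral_ge0.
(* The maximum with 1 keeps the level spacing [c = K / n] positive. *)
pose K := Num.max M 1; have K0 : 0 < K by rewrite lt_max ltr01 orbT.
have approx (n : nat) : (0 < n)%N -> `|e| <= K / n%:R * a.
  move=> n0; set c := K / n%:R.
  have c0 : 0 < c by rewrite divr_gt0 // ltr0n.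
  pose A (j : nat) := h @^-1` [set y | j.+1%:R * c <= y].
  have HA j : H (A j).
    apply: Hh; have := measurable_itv `[j.+1%:R * c, +oo[.
    by congr measurable; apply/seteqP; split => y /=; rewrite in_itv /= andbT.
  have bA j : ae_bounded P (fun w => \1_(A j) w * G w).
    by apply: ae_boundedM => //; exact/ae_bounded_indic/measurable_H.
  pose r w := h w * G w - c * \sum_(j < n) \1_(A j) w * G w.
  have br : ae_bounded P r.
    apply: ae_boundedB; first exact: ae_boundedM.
    by apply: ae_boundedZ; exact: ae_bounded_sum.
  have er : \int[P]_w r w = e.
    rewrite ExpB; [|exact: ae_boundedM|by apply: ae_boundedZ; exact: ae_bounded_sum].
    rewrite ExpZ; last exact: ae_bounded_sum.
    by rewrite Exp_sum // big1 ?mulr0 ?subr0 // => j _; exact: HG.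
  have rG w : `|r w| <= c * `|G w|.
    rewrite /r -mulr_suml mulrA -mulrBl normrM ler_wpM2r //.
    have -> : \sum_(j < n) \1_(A j) w = \sum_(j < n) (j.+1%:R * c <= h w)%R%:R :> R.
      apply: eq_bigr => j _; rewrite indicE; congr (nat_of_bool _)%:R.
      by apply/idP/idP; rewrite inE.
    apply: layer_count => //; case/andP: (hM w) => -> /= h1.
    by rewrite mulrC /c divfK ?pnatr_eq0 -?lt0n // le_max h1.
  have bc : ae_bounded P (fun w => c * `|G w|) by exact: ae_boundedZ.
  rewrite ler_norml -er -ExpZ //; apply/andP; split.
    rewrite lerNl -mulN1r -ExpZ //; apply: le_Exp => // [|w].
      exact: ae_boundedZ.
    by rewrite mulN1r (le_trans _ (rG w)) // ler_normr lexx orbT.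
  by apply: le_Exp => // w; rewrite (le_trans (ler_norm _)).
apply/eqP; rewrite -normr_eq0 eq_le normr_ge0 andbT leNgt; apply/negP => e0.
have Ka : 0 <= K * a / `|e| by rewrite divr_ge0 ?mulr_ge0 // ltW.
(* An [n] above [K * a / |e|] contradicts [approx]. *)
have := archi_boundP Ka; set n := Num.bound _ => hn.
have n0 : (0 < n)%N by rewrite -(@ltr0n R) (le_lt_trans Ka).
have := approx _ n0; rewrite mulrAC ler_pdivlMr ?ltr0n // mulrC.
by move: hn; rewrite ltr_pdivrMr // => hn /le_lt_trans/(_ hn); rewrite ltxx.
Qed.

Variables (lo Delta : R) (N : nat) (X Q : T -> R).
Hypotheses (Delta_gt0 : 0 < Delta)
  (hX : forall w, lo <= X w <= lo + N%:R * Delta)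
  (mX : measurable_fun [set: T] X) (mQ : measurable_fun [set: T] Q)
  (hlaw : forall A B, H A -> measurable B ->
    P (A `&` [set w | B (Q w)]) =
    (\int[P]_(w in A) quant_law lo Delta (X w) B)%E).
Local Notation tau s := (lo + s%:R * Delta).
Local Notation atom s w := ((Q w == lo + s%:R * Delta)%:R : R).

Let ae_bounded_X : ae_bounded P X.
Proof.
apply: (@ae_bounded_pt _ _ _ P _ (`|lo| + N%:R * Delta)) => // w.
have ND : 0 <= N%:R * Delta by rewrite mulr_ge0 // ltW.
case/andP: (hX w) => h1 h2; rewrite ler_norml; apply/andP; split.
  by have := ler_normr (- lo) lo; have := lerNnormlW (lexx `|lo|); lra.
by have := ler_norm lo; lra.
Qed.

Let ae_bounded_atom s : ae_bounded P (fun w => atom s w).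
Proof.
have -> : (fun w => atom s w) = \1_(Q @^-1` [set tau s]).
  apply/funext => w; rewrite indicE; congr (nat_of_bool _)%:R.
  by apply/eqP/idP; rewrite inE.
apply: ae_bounded_indic; rewrite -[_ @^-1` _]setTI; exact: mQ.
Qed.

Let ae_bounded_hat s : ae_bounded P (fun w => hat lo Delta s (X w)).
Proof.
apply: (@ae_bounded_pt _ _ _ P _ 1) => [|w].
  apply: measurable_maxr => //; apply: measurable_funB => //.
  apply: measurable_funM => //; apply: measurableT_comp => //.
  exact: measurable_funB.
rewrite ger0_norm /hat ?le_max ?lexx // ge_max ler01 /= gerBl.
by rewrite divr_ge0 // ltW.
Qed.

(** The conditional law is read at a single grid point, whose mass is given by the tent function. *)
Lemma Exp_atom A s : H A ->
  \int[P]_w (\1_A w * atom s w) = \int[P]_w (\1_A w * hat lo Delta s (X w)).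
Proof.
move=> HA; have mA := measurable_H HA.
have mQs : measurable (Q @^-1` [set tau s]).
  by rewrite -[_ @^-1` _]setTI; exact: mQ.
transitivity (fine (P (A `&` [set w | [set tau s] (Q w)]))).
  rewrite -Exp_indic; last exact: measurableI.
  apply: eq_Rintegral => w _; rewrite indicI /= !indicE; congr (_ * _).
  by congr (nat_of_bool _)%:R; apply/eqP/idP; rewrite inE.
rewrite (@hlaw A [set tau s] HA (measurable_set1 _)).
under eq_integral do rewrite quant_law_atom //.
rewrite -[LHS]/(\int[P]_(w in A) hat lo Delta s (X w)) Rintegral_mkcond.
apply: eq_Rintegral => w _; rewrite patchE indicE.
by case: ifP; rewrite ?mul1r ?mul0r.
Qed.

Let sum_atom_le1 w : \sum_(s < N.+1) atom s w <= 1.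
Proof.
have [[s /eqP hs]|hn] := pselect (exists s : 'I_N.+1, Q w == tau s); last first.
  rewrite big1 // => s _; case: eqP => // /eqP e.
  by case: hn; exists s.
rewrite (bigD1 s) //= hs eqxx big1 ?addr0 // => s' s's.
rewrite (inj_eq (addrI _)) (inj_eq (mulIf (lt0r_neq0 Delta_gt0))) eqr_nat.
by rewrite eq_sym (negPf (_ : s' != s :> nat)).
Qed.

(** The grid points are distinct, so the sum is at most 1; its expectation is that of the sum of the
    tents, which is 1. Hence it is almost surely 1: [Q] falls on the grid. *)
Lemma ae_sum_atom : \forall w \ae P, \sum_(s < N.+1) atom s w = 1.
Proof.
have ba : ae_bounded P (fun w => \sum_(s < N.+1) atom s w).
  by apply: ae_bounded_sum.
have : \forall w \ae P, 1 - \sum_(s < N.+1) atom s w = 0.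
  apply: Exp_ge0_eq0; first by apply: ae_boundedB => //; exact: ae_bounded_cst.
    by move=> w; rewrite subr_ge0 sum_atom_le1.
  rewrite ExpB //; last exact: ae_bounded_cst.
  rewrite Exp_cst Exp_sum //; apply/eqP; rewrite subr_eq0; apply/eqP.
  transitivity (\int[P]_w hat_mean lo Delta N (fun=> 1) (X w)).
    under eq_Rintegral do rewrite hat_mean_cst //.
    by rewrite Exp_cst.
  rewrite /hat_mean; under eq_Rintegral do under eq_bigr do rewrite mul1r.
  rewrite Exp_sum //; apply: eq_bigr => s _.
  have := Exp_atom s H_setT.
  under eq_Rintegral do rewrite indicT mul1r.
  by under [in X in _ = X -> _]eq_Rintegral do rewrite indicT mul1r.
by apply: filterS => w /eqP; rewrite subr_eq0 => /eqP.
Qed.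

Lemma ae_quant (phi : R -> R) :
  \forall w \ae P, phi (Q w) = \sum_(s < N.+1) phi (tau s) * atom s w.
Proof.
apply: filterS ae_sum_atom => w e; rewrite -[LHS]mulr1 -[X in _ * X = _]e mulr_sumr.
by apply: eq_bigr => s _; case: eqP => [->//|_]; rewrite !mulr0.
Qed.

Lemma ae_bounded_quant (phi : R -> R) :
  measurable_fun [set: T] (phi \o Q) -> ae_bounded P (phi \o Q).
Proof.
move=> mphi; split=> //; exists (\sum_(s < N.+1) `|phi (tau s)|).
apply: filterS (ae_quant phi) => w /= ->.
apply: le_trans (ler_norm_sum _ _ _) _; apply: ler_sum => s _.
rewrite normrM ler_piMr //.
by case: eqP; rewrite ?normr1 ?normr0.
Qed.

(** In other words, the conditional expectation of [phi (Q w)] given [H] is [hat_mean] of [phi] at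
    [X w]. On the grid [phi (Q w)] is a finite combination of atoms, to which [Exp_atom] applies. *)
Lemma Exp_quant (phi : R -> R) A : H A ->
  measurable_fun [set: T] (phi \o Q) ->
  \int[P]_w (\1_A w * phi (Q w)) =
    \int[P]_w (\1_A w * hat_mean lo Delta N phi (X w)).
Proof.
move=> HA mphi; have bA := @ae_bounded_indic _ _ _ P _ (measurable_H HA).
have bat s : ae_bounded P (fun w => phi (tau s) * (\1_A w * atom s w)).
  by apply: ae_boundedZ; exact: ae_boundedM.
have bhat s : ae_bounded P (fun w => phi (tau s) * (\1_A w * hat lo Delta s (X w))).
  by apply: ae_boundedZ; exact: ae_boundedM.
transitivity (\int[P]_w (\sum_(s < N.+1) phi (tau s) * (\1_A w * atom s w))).
  apply: ae_eq_Exp.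
  - by apply: ae_boundedM => //; exact: ae_bounded_quant.
  - exact: ae_bounded_sum.
  apply: filterS (ae_quant phi) => w ->; rewrite mulr_sumr.
  by apply: eq_bigr => s _; rewrite mulrCA.
rewrite Exp_sum //; transitivity (\int[P]_w (\sum_(s < N.+1)
    phi (tau s) * (\1_A w * hat lo Delta s (X w)))).
  rewrite Exp_sum //; apply: eq_bigr => s _.
  rewrite !ExpZ ?Exp_atom //; exact: ae_boundedM.
apply: eq_Rintegral => w _; rewrite mulr_sumr.
by apply: eq_bigr => s _; rewrite mulrCA.
Qed.

Lemma ae_bounded_quant_error : ae_bounded P (fun w => Q w - X w).
Proof. by apply: ae_boundedB => //; exact: (@ae_bounded_quant id). Qed.

Lemma Exp_indic_quant_error A : H A -> \int[P]_w (\1_A w * (Q w - X w)) = 0.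
Proof.
move=> HA; have bA := @ae_bounded_indic _ _ _ P _ (measurable_H HA).
under eq_Rintegral do rewrite mulrBr.
rewrite ExpB; [|by apply: ae_boundedM => //; exact: (@ae_bounded_quant id)|
  exact: ae_boundedM].
rewrite (@Exp_quant id) //; under eq_Rintegral do rewrite hat_mean_id //.
by rewrite subrr.
Qed.

Lemma Exp_quant_error : \int[P]_w (Q w - X w) = 0.
Proof.
rewrite -[RHS](Exp_indic_quant_error H_setT).
by apply: eq_Rintegral => w _; rewrite indicT mul1r.
Qed.

Lemma Exp_mul_quant_error (h : T -> R) (a b : R) :
  (forall w, a <= h w <= b) -> (forall B, measurable B -> H (h @^-1` B)) ->
  \int[P]_w (h w * (Q w - X w)) = 0.
Proof.
move=> hab Hh; have be := ae_bounded_quant_error.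
have mh : measurable_fun setT h.
  by move=> _ B mB; rewrite setTI; exact/measurable_H/Hh.
have bha : ae_bounded P (fun w => h w - a).
  apply: (@ae_bounded_pt _ _ _ P _ (b - a)); first exact: measurable_funB.
  by move=> w; case/andP: (hab w) => h1 h2; rewrite ger0_norm; lra.
(* Subtracting [a] makes the factor nonnegative, as [Exp_mul_eq0] requires; the constant part
   contributes [a] times a mean-zero error. *)
transitivity (\int[P]_w ((h w - a) * (Q w - X w) + a * (Q w - X w))).
  by apply: eq_Rintegral => w _; rewrite -mulrDl subrK.
rewrite ExpD; [|exact: ae_boundedM|exact: ae_boundedZ].
rewrite ExpZ // Exp_quant_error mulr0 addr0.
apply: (@Exp_mul_eq0 _ _ (b - a)) => //.
- by move=> w; case/andP: (hab w) => h1 h2; apply/andP; split; lra.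
- move=> B mB; pose B' := (fun y => y - a) @^-1` B.
  have mB' : measurable B'.
    have mf : measurable_fun setT (fun y : R => y - a) by exact: measurable_funB.
    by rewrite -[B']setTI; exact: mf.
  exact: (Hh _ mB').
- exact: Exp_indic_quant_error.
Qed.

Lemma Exp_quant_error_sqr :
  (forall B, measurable B -> H (X @^-1` B)) ->
  \int[P]_w ((Q w - X w) ^+ 2) <= Num.min Delta (N%:R * Delta) ^+ 2 / 4.
Proof.
move=> HX; set v := _ / 4.
have bQ2 : ae_bounded P (fun w => Q w ^+ 2).
  by apply: ae_boundedX; exact: (@ae_bounded_quant id).
have bX2 : ae_bounded P (fun w => X w ^+ 2) by exact: ae_boundedX.
have bXe : ae_bounded P (fun w => X w * (Q w - X w)).
  by apply: ae_boundedM => //; exact: ae_bounded_quant_error.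
have b1 : ae_bounded P (fun w => Q w ^+ 2 - X w ^+ 2) by exact: ae_boundedB.
(* The square is rewritten so that its cross term [X * (Q - X)] has mean zero. *)
have -> : \int[P]_w ((Q w - X w) ^+ 2) =
    \int[P]_w ((Q w ^+ 2 - X w ^+ 2) - 2 * (X w * (Q w - X w))).
  by apply: eq_Rintegral => w _; ring.
rewrite ExpB //; last exact: ae_boundedZ.
rewrite ExpZ // (Exp_mul_quant_error hX HX) mulr0 subr0 ExpB //.
have -> : \int[P]_w (Q w ^+ 2) =
    \int[P]_w hat_mean lo Delta N (fun y => y ^+ 2) (X w).
  have mQ2 : measurable_fun setT ((fun y => y ^+ 2) \o Q) by case: bQ2.
  have := Exp_quant H_setT mQ2.
  under eq_Rintegral do rewrite indicT mul1r.
  by under [in X in _ = X -> _]eq_Rintegral do rewrite indicT mul1r.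
rewrite lerBlDr -[v](Exp_cst P) -ExpD //; last exact: ae_bounded_cst.
apply: le_Exp.
- rewrite /hat_mean; apply: ae_bounded_sum => s; exact: ae_boundedZ.
- by apply: ae_boundedD => //; exact: ae_bounded_cst.
- by move=> w; rewrite addrC; exact: hat_mean_sqr.
Qed.

End ConditionalQuantization.

(** * Expected one-step decrease *)

Section History.
Context (disp : measure_display) (T : measurableType disp) (R : realType).
Variables (n d : nat) (x q : process T R n d) (k : nat).
Hypotheses (hx : random_process x) (hq : random_process q).

Lemma measurable_history A : history x q k A -> measurable A.
Proof.
apply: smallest_sub; first exact: sigma_algebra_measurable.
move=> B [i [t [m [C [mC [[_ ->]|[_ ->]]]]]]].
  by rewrite -[_ @^-1` _]setTI; exact: hx.
by rewrite -[_ @^-1` _]setTI; exact: hq.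
Qed.

Lemma history_setT : history x q k setT.
Proof.
have [h0 hC _] : sigma_algebra setT (history x q k).
  exact: smallest_sigma_algebra.
by rewrite -[setT]setD0; exact: hC.
Qed.

Lemma history_state i m (B : set R) : measurable B ->
  history x q k ((fun w => x i k w 0 m) @^-1` B).
Proof.
move=> mB; apply: sub_gen_smallest; exists i, k, m, B; split=> //.
by left; rewrite leqnn.
Qed.

End History.

Section StepExpectation.
Context (disp : measure_display) (T : measurableType disp) (R : realType).
Variables (P : probability T R) (n d : nat) (l u Delta xs : 'rV[R]_d).
Variables (N : 'I_d -> nat).
Variables (f : 'I_n -> 'rV[R]_d -> R) (g : 'I_n -> 'rV[R]_d -> 'rV[R]_d).
Variables (Li mui : 'I_n -> R) (mu : R) (A : 'M[R]_n) (sigma alpha beta : R).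
Variables (x q : process T R n d) (k : nat).
Local Notation X := (box l u).
Local Notation L := (\sum_i Li i).
Hypotheses (hgrid : uniform_grid l u Delta N)
  (hLi : forall i, 0 <= Li i)
  (hlip : forall i, lipschitz_bound_on X (Li i) (f i))
  (hgL : forall i y, X y -> fnorm (g i y) <= Li i)
  (hstrong : forall i, strongly_convex_on X (mui i) (f i) (g i))
  (hmu : forall i, mu <= mui i)
  (hxs : minimizer_on X (fun y => \sum_i f i y) xs)
  (n_gt0 : (0 < n)%N)
  (hA : doubly_stochastic A) (hs : second_singular_value A sigma)
  (hsigma : 0 <= sigma <= 3 / 8) (alpha_ge0 : 0 <= alpha)
  (hbeta : 0 < beta <= 1)
  (hx : random_process x) (hq : random_process q)
  (hfresh : fresh_quantization P l Delta x q)
  (Xx : forall i t w, X (x i t w))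
  (hproj : forall i w, is_proj X ((1 - beta) *: x i k w
     + beta *: (\sum_j A i j *: q j k w) - alpha *: g i (x i k w))
     (x i k.+1 w)).

Local Notation kappa :=
  (fun m => Num.min (Delta 0 m) ((N m)%:R * Delta 0 m) ^+ 2 / 4).
Local Notation V := (\sum_m kappa m).
Local Notation nu := (fun j w m => q j k w 0 m - x j k w 0 m).

Lemma ae_bounded_state i t m : ae_bounded P (fun w => x i t w 0 m).
Proof.
apply: (@ae_bounded_pt _ _ _ P _ (`|l 0 m| + `|u 0 m|)); first exact: hx.
move=> w; case/andP: (Xx i t w m) => h1 h2; rewrite ler_norml.
have := ler_norm (- l 0 m); have := ler_norm (u 0 m).
have := normr_ge0 (l 0 m); have := normr_ge0 (u 0 m); rewrite normrN => *.
by apply/andP; split; lra.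
Qed.

Lemma ae_bounded_state_sqr i t (c : 'rV[R]_d) :
  ae_bounded P (fun w => fnorm (x i t w - c) ^+ 2).
Proof.
have -> : (fun w => fnorm (x i t w - c) ^+ 2)
    = (fun w => \sum_m (x i t w 0 m - c 0 m) ^+ 2).
  apply/funext => w; rewrite fnorm_sqr; apply: eq_bigr => m _.
  by rewrite !mxE expr2.
apply: ae_bounded_sum => m; apply: ae_boundedX; apply: ae_boundedB.
  exact: ae_bounded_state.
exact: ae_bounded_cst.
Qed.

Let mH := measurable_history (k := k) hx hq.
Let HT : history x q k setT. Proof. exact: history_setT. Qed.
Let Delta_gt0 m : 0 < Delta 0 m. Proof. by case: (hgrid m). Qed.
Let grid_state j m w :
  l 0 m <= x j k w 0 m <= l 0 m + (N m)%:R * Delta 0 m.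
Proof. by case: (hgrid m) => _ <-; exact: Xx. Qed.

Lemma ae_bounded_error j m : ae_bounded P (fun w => nu j w m).
Proof.
exact: (ae_bounded_quant_error mH HT (Delta_gt0 m) (grid_state j m)
  (hx j k m) (hq j k m) (@hfresh j k m)).
Qed.

(** The state of every node [i] at time [k] belongs to the history on which the error of node [j] is
    conditioned. *)
Lemma Exp_state_error i j m : \int[P]_w (x i k w 0 m * nu j w m) = 0.
Proof.
apply: (Exp_mul_quant_error mH HT (Delta_gt0 m) (grid_state j m)
  (hx j k m) (hq j k m) (@hfresh j k m) (grid_state i m)).
by move=> B; exact: history_state.
Qed.

Lemma Exp_error j m : \int[P]_w (nu j w m) = 0.
Proof.
exact: (Exp_quant_error mH HT (Delta_gt0 m) (grid_state j m)
  (hx j k m) (hq j k m) (@hfresh j k m)).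
Qed.

Lemma Exp_error_sqr j m : \int[P]_w (nu j w m ^+ 2) <= kappa m.
Proof.
apply: (Exp_quant_error_sqr mH HT (Delta_gt0 m) (grid_state j m)
  (hx j k m) (hq j k m) (@hfresh j k m)).
by move=> B; exact: history_state.
Qed.

Local Notation mix i w :=
  ((1 - beta) *: x i k w + beta *: \sum_j A i j *: x j k w).
Local Notation noise i w := (\sum_j A i j *: (q j k w - x j k w)).

Let dot_noiseE i w : dot (mix i w - xs) (noise i w) =
  \sum_m \sum_j A i j * ((1 - beta) * (x i k w 0 m * nu j w m)
    + beta * (\sum_j' A i j' * (x j' k w 0 m * nu j w m))
    - xs 0 m * nu j w m).
Proof.
rewrite /dot; apply: eq_bigr => m _; rewrite [X in _ * X]summxE mulr_sumr.
apply: eq_bigr => j _; rewrite !mxE summxE.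
have -> : \sum_j' A i j' * (x j' k w 0 m * nu j w m) =
    (\sum_j' (A i j' *: x j' k w) 0 m) * nu j w m.
  by rewrite mulr_suml; apply: eq_bigr => j' _; rewrite mxE mulrA.
by ring.
Qed.

Let ae_bounded_state_error i j m :
  ae_bounded P (fun w => x i k w 0 m * nu j w m).
Proof. exact: ae_boundedM (ae_bounded_state _ _ _) (ae_bounded_error _ _). Qed.

Let ae_bounded_dot_term i j m : ae_bounded P (fun w =>
  A i j * ((1 - beta) * (x i k w 0 m * nu j w m)
    + beta * (\sum_j' A i j' * (x j' k w 0 m * nu j w m))
    - xs 0 m * nu j w m)).
Proof.
apply: ae_boundedZ; apply: ae_boundedB; last first.
  by apply: ae_boundedZ; exact: ae_bounded_error.
apply: ae_boundedD; apply: ae_boundedZ => //.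
by apply: ae_bounded_sum => j'; exact: ae_boundedZ.
Qed.

Lemma ae_bounded_dot_noise i :
  ae_bounded P (fun w => dot (mix i w - xs) (noise i w)).
Proof.
under eq_fun do rewrite dot_noiseE.
by apply: ae_bounded_sum => m; exact: ae_bounded_sum.
Qed.

Lemma Exp_dot_noise i : \int[P]_w dot (mix i w - xs) (noise i w) = 0.
Proof.
under eq_Rintegral do rewrite dot_noiseE.
rewrite Exp_sum; last by move=> m; exact: ae_bounded_sum.
rewrite big1 // => m _; rewrite Exp_sum // big1 // => j _.
have bs : ae_bounded P
    (fun w => \sum_j' A i j' * (x j' k w 0 m * nu j w m)).
  by apply: ae_bounded_sum => j'; exact: ae_boundedZ.
have be := ae_bounded_error j m.
have b1 := ae_boundedZ (1 - beta) (ae_bounded_state_error i j m).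
have b2 := ae_boundedZ beta bs; have b3 := ae_boundedZ (xs 0 m) be.
rewrite ExpZ; last by apply: ae_boundedB => //; exact: ae_boundedD.
rewrite ExpB //; last exact: ae_boundedD.
rewrite ExpD // !ExpZ // Exp_state_error Exp_error Exp_sum; last first.
  by move=> j'; exact: ae_boundedZ.
rewrite big1 ?mulr0 ?addr0 ?subr0 ?mulr0 // => j' _.
by rewrite ExpZ // Exp_state_error mulr0.
Qed.

Let error_sqrE j w : fnorm (q j k w - x j k w) ^+ 2 = \sum_m nu j w m ^+ 2.
Proof. by rewrite fnorm_sqr; apply: eq_bigr => m _; rewrite !mxE expr2. Qed.

Lemma ae_bounded_error_sqr j :
  ae_bounded P (fun w => fnorm (q j k w - x j k w) ^+ 2).
Proof.
under eq_fun do rewrite error_sqrE.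
by apply: ae_bounded_sum => m; apply: ae_boundedX; exact: ae_bounded_error.
Qed.

Lemma Exp_error_fnorm_sqr j :
  \int[P]_w (fnorm (q j k w - x j k w) ^+ 2) <= V.
Proof.
under eq_Rintegral do rewrite error_sqrE.
rewrite Exp_sum; last by move=> m; apply: ae_boundedX; exact: ae_bounded_error.
by apply: ler_sum => m _; exact: Exp_error_sqr.
Qed.

Variable lam : R.
Hypotheses (lam_ge0 : 0 <= lam) (lam_gt0 : 0 < L -> 0 < lam)
  (V_le : V <= lam ^+ 2).

(* As g i o x i k need not be measurable, the term
   -2 alpha beta <g i (x i k), noise> is not known to have mean zero: it is
   bounded by Cauchy-Schwarz, followed by 2 c <= lam + c^2 / lam. *)
Lemma noise_term_le i w :
  2 * beta * dot (mix i w - xs) (noise i w)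
    + beta ^+ 2 * fnorm (noise i w) ^+ 2
    + 2 * alpha * beta * Li i * fnorm (noise i w) <=
  2 * beta * dot (mix i w - xs) (noise i w)
    + ((beta ^+ 2 + alpha * beta * Li i / lam) *
       (\sum_j A i j * fnorm (q j k w - x j k w) ^+ 2)
       + alpha * beta * Li i * lam).
Proof.
have [A0 rows _] := hA.
have b0 : 0 < beta by case/andP: hbeta.
have c0 : 0 <= alpha * beta * Li i.
  by apply: mulr_ge0 => //; apply: mulr_ge0 => //; exact: ltW.
have Nle := fnorm_sqr_convex (fun j => q j k w - x j k w) (A0 i) (rows i).
have young : 2 * alpha * beta * Li i * fnorm (noise i w) <=
    alpha * beta * Li i / lam * fnorm (noise i w) ^+ 2
    + alpha * beta * Li i * lam.
  (* [lam] is only known to be positive when [L] is, so [Li i = 0] is settled first. *)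
  have [Li0|Lin0] := eqVneq (Li i) 0; first by rewrite Li0 !(mulr0, mul0r) addr0.
  have lam0 : 0 < lam.
    apply: lam_gt0; rewrite (bigD1 i) //= ltr_wpDr ?sumr_ge0 //.
    by rewrite lt0r Lin0 hLi.
  set a := alpha * beta * Li i in c0 *; set y := fnorm _.
  have -> : 2 * alpha * beta * Li i * y = a * (2 * y) by rewrite /a; ring.
  have -> : a / lam * y ^+ 2 + a * lam = a * (y ^+ 2 / lam + lam) by ring.
  rewrite ler_wpM2l // -subr_ge0.
  have -> : y ^+ 2 / lam + lam - 2 * y = (y - lam) ^+ 2 / lam.
    by field; rewrite gt_eqF.
  by rewrite divr_ge0 ?sqr_ge0 // ltW.
have h : 0 <= beta ^+ 2 + alpha * beta * Li i / lam.
  by rewrite addr_ge0 ?sqr_ge0 // divr_ge0.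
have := ler_wpM2l h Nle; lra.
Qed.

Local Notation S t w := (\sum_i fnorm (x i t w - xs) ^+ 2).

Lemma ae_bounded_sum_sqr t : ae_bounded P (fun w => S t w).
Proof. by apply: ae_bounded_sum => i; exact: ae_bounded_state_sqr. Qed.

(** In the expectation of [step_le] the products with the noise vanish, and the averaged squared
    errors are at most [V]. The gradient-noise term becomes [alpha * beta * L * (V / lam + lam)],
    and [V <= lam ^+ 2] makes the bracket at most [2 * lam]. *)
Lemma step_Exp :
  \int[P]_w S k.+1 w <= (1 - 2 * alpha * mu) * \int[P]_w S k w
    + (6 * alpha ^+ 2 * L ^+ 2 / (beta * (1 - sigma)) + alpha ^+ 2 * L ^+ 2
       + (n%:R * beta ^+ 2 * V + 2 * alpha * beta * L * lam)).
Proof.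
have [A0 rows _] := hA.
have b0 : 0 < beta by case/andP: hbeta.
set K := 6 * alpha ^+ 2 * _ / _ + _.
pose B i w := 2 * beta * dot (mix i w - xs) (noise i w)
    + ((beta ^+ 2 + alpha * beta * Li i / lam) *
       (\sum_j A i j * fnorm (q j k w - x j k w) ^+ 2)
       + alpha * beta * Li i * lam).
have bAe i : ae_bounded P
    (fun w => \sum_j A i j * fnorm (q j k w - x j k w) ^+ 2).
  by apply: ae_bounded_sum => j; apply: ae_boundedZ; exact: ae_bounded_error_sqr.
have bdn i : ae_bounded P
    (fun w => 2 * beta * dot (mix i w - xs) (noise i w)).
  by apply: ae_boundedZ; exact: ae_bounded_dot_noise.
have bB2 i : ae_bounded P (fun w => (beta ^+ 2 + alpha * beta * Li i / lam) *
       (\sum_j A i j * fnorm (q j k w - x j k w) ^+ 2)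
       + alpha * beta * Li i * lam).
  by apply: ae_boundedD; [exact: ae_boundedZ|exact: ae_bounded_cst].
have bB i : ae_bounded P (B i) by exact: ae_boundedD.
have bS t := ae_bounded_sum_sqr t.
have bcS := ae_boundedZ (1 - 2 * alpha * mu) (bS k).
have bcSK : ae_bounded P (fun w => (1 - 2 * alpha * mu) * S k w + K).
  by apply: ae_boundedD => //; exact: ae_bounded_cst.
have bsB : ae_bounded P (fun w => \sum_i B i w) by exact: ae_bounded_sum.
apply: (@le_trans _ _
  (\int[P]_w ((1 - 2 * alpha * mu) * S k w + K + \sum_i B i w))).
  apply: le_Exp => // [|w]; first exact: ae_boundedD.
  have := @step_le R n d l u xs f g Li mui mu A sigma alpha beta hLi hlip hgL
    hstrong hmu hxs (fun i => x i k w) (fun i => Xx i k w) n_gt0 hA hs hsigma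
    alpha_ge0 hbeta (fun i => q i k w) (fun i => x i k.+1 w)
    (fun i => hproj i w).
  move=> /le_trans; apply; rewrite /K [X in _ <= X + _]addrA lerD2l.
  by apply: ler_sum => i _; exact: noise_term_le.
rewrite ExpD // ExpD //; last exact: ae_bounded_cst.
rewrite ExpZ // Exp_cst -addrA lerD2l lerD2l Exp_sum //.
have EB i : \int[P]_w B i w <=
    beta ^+ 2 * V + (V / lam + lam) * (alpha * beta * Li i).
  rewrite /B ExpD // ExpZ; last exact: ae_bounded_dot_noise.
  rewrite Exp_dot_noise mulr0 add0r ExpD; [|exact: ae_boundedZ|exact: ae_bounded_cst].
  rewrite Exp_cst ExpZ // Exp_sum; last first.
    by move=> j; apply: ae_boundedZ; exact: ae_bounded_error_sqr.
  have h : \sum_j \int[P]_w (A i j * fnorm (q j k w - x j k w) ^+ 2) <= V.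
    rewrite -[V]mul1r -[X in _ <= X * _](rows i) mulr_suml; apply: ler_sum => j _.
    rewrite ExpZ; last exact: ae_bounded_error_sqr.
    by apply: ler_wpM2l => //; exact: Exp_error_fnorm_sqr.
  have c0 : 0 <= alpha * beta * Li i.
    by apply: mulr_ge0 => //; apply: mulr_ge0 => //; exact: ltW.
  have h0 : 0 <= beta ^+ 2 + alpha * beta * Li i / lam.
    by rewrite addr_ge0 ?sqr_ge0 // divr_ge0.
  have := ler_wpM2l h0 h; move: (\sum_j _) => z; lra.
apply: le_trans (ler_sum _ (fun i _ => EB i)) _.
rewrite big_split /= sumr_const card_ord -[X in _ + X <= _]mulr_sumr.
rewrite -(mulr_sumr _ _ Li) -[_ *+ n]mulr_natl [X in X + _ <= _]mulrA lerD2l.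
(* For [lam = 0] the inverse is 0 by convention and the bound is trivial. *)
have Vlam : V / lam <= lam.
  have [->|l0] := eqVneq lam 0; first by rewrite invr0 mulr0.
  have lp : 0 < lam by rewrite lt0r l0.
  by rewrite ler_pdivrMr // -expr2.
have cL : 0 <= alpha * beta * L.
  by apply: mulr_ge0; [apply: mulr_ge0 => //; exact: ltW|exact: sumr_ge0].
have := ler_wpM2r cL (lerD Vlam (lexx lam)); lra.
Qed.

End StepExpectation.

(** * Summation of the recursion *)

Section Summation.
Variable R : realType.
Local Notation cbrt n := ((n%:R : R) `^ (1 / 3)).

Lemma powR13X (y : R) : 0 <= y -> (y `^ (1 / 3)) ^+ 3 = y.
Proof.
move=> y0; rewrite -powR_mulrn ?powR_ge0 // -powRrM.
by rewrite mul1r mulVf ?pnatr_eq0 // powRr1.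
Qed.

Lemma powR23E (y : R) : y `^ (2 / 3) = (y `^ (1 / 3)) ^+ 2.
Proof. by rewrite -powR_mulrn ?powR_ge0 // -powRrM mul1r mulrC. Qed.

Lemma cbrt_gt0 n : 0 < cbrt n.+1.
Proof. by rewrite powR_gt0. Qed.

Lemma le_cbrt n m : (n <= m)%N -> cbrt n <= cbrt m.
Proof. by move=> nm; rewrite ge0_ler_powR ?nnegrE ?ler_nat // divr_ge0. Qed.

(* With c^3 - e^3 = 1 this is c^3 + 2 e^3 >= 3 c e^2. *)
Lemma inv_cbrt_le n :
  (cbrt n.+2)^-1 <= 3 / 2 * (cbrt n.+2 ^+ 2 - cbrt n.+1 ^+ 2).
Proof.
have := powR13X (ler0n R n.+2); have := powR13X (ler0n R n.+1).
have := cbrt_gt0 n; have := cbrt_gt0 n.+1; rewrite -[n.+2%:R]natr1.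
move: (n.+1%:R) => y; move: (_ `^ _) (y `^ _) => c e c0 e0 eE cE.
rewrite -[c^-1]mul1r ler_pdivrMr //.
have := mulr_ge0 (sqr_ge0 (c - e)) (ltW (ltr_pwDl c0 (ltW e0))).
have : 0 <= e * (c - e) ^+ 2 by rewrite mulr_ge0 ?sqr_ge0 // ltW.
by nra.
Qed.

(** This is ln (1 + t) <= t at t = -1 / (n + 2). *)
Lemma inv_le_ln n : (n.+2%:R : R)^-1 <= ln n.+2%:R - ln n.+1%:R.
Proof.
have n1 : (0 : R) < n.+1%:R by rewrite ltr0n.
have n2 : (0 : R) < n.+2%:R by rewrite ltr0n.
have q0 : (0 : R) < n.+1%:R / n.+2%:R by rewrite divr_gt0.
rewrite -lerN2 opprB -ln_div ?posrE //.
have -> : - (n.+2%:R : R)^-1 = n.+1%:R / n.+2%:R - 1.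
  move: n2; rewrite -[n.+2%:R]natr1 => n2.
  by field; exact: lt0r_neq0.
have := @le_ln1Dx R (n.+1%:R / n.+2%:R - 1).
by rewrite addrCA subrr addr0; apply; move: q0; set r := _ / _; lra.
Qed.

(** The potential is [k.+1%:R * S k]. Since (k + 2) S_k = (k + 1) S_k + S_k, each step releases
    [(rho - 1) * S k]; the two error terms are summed by [inv_cbrt_le] and [inv_le_ln]. *)
Lemma sum_recursion (S : nat -> R) (rho C1 C2 : R) : 0 <= C1 -> 0 <= C2 ->
  (forall k, k.+2%:R * S k.+1 <= (k.+2%:R - rho) * S k
     + (C1 / cbrt k.+2 + C2 / k.+2%:R)) ->
  forall k, (rho - 1) * \sum_(t < k) S t + k.+1%:R * S k <=
    S 0%N + 3 / 2 * C1 * (cbrt k.+1 ^+ 2 - 1) + C2 * ln k.+1%:R.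
Proof.
move=> C10 C20 rec; elim=> [|k IH].
  by rewrite big_ord0 powR1 ln1; lra.
have h1 := ler_wpM2l C10 (inv_cbrt_le k).
have h2 := ler_wpM2l C20 (inv_le_ln k).
have h3 := rec k.
have e : k.+2%:R * S k = k.+1%:R * S k + S k by rewrite -[k.+2%:R]natr1; ring.
rewrite big_ord_recr /=; move: h1 h2 h3 e IH.
move: (k.+2%:R) (k.+1%:R) (cbrt k.+2) (cbrt k.+1) (ln k.+2%:R) (ln k.+1%:R).
move: (\sum_(t < k) _) (S k.+1) (S k) (S 0%N) => *. lra.
Qed.

Lemma cbrt2_bounds : 3 / 2 <= cbrt 2 ^+ 2 <= 8 / 5 /\ cbrt 2 <= 4 / 3.
Proof.
have := powR13X (ler0n R 2); have := cbrt_gt0 1; move: (cbrt 2) => c c0 c3.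
have c6 : (c ^+ 2) ^+ 3 = 4 by rewrite exprAC c3; ring.
have c20 : 0 <= c ^+ 2 by rewrite sqr_ge0.
(* The bounds are compared after cubing: 27/8 <= 4 <= 512/125 and 2 <= 64/27. *)
have cube (y z : R) : 0 <= y -> 0 <= z -> y ^+ 3 <= z ^+ 3 -> y <= z.
  by move=> y0 z0; rewrite ler_pXn2r.
by split; [apply/andP; split|]; apply: cube => //;
  rewrite ?c6 ?c3 ?(ltW c0) //; lra.
Qed.

(** Final arithmetic, with [nr] = n, [eta] = 1 - sigma2, [Q] = L^2, [D2] = D^2, [m] = k + 2, [lnm] =
    ln m; [c] and [c2] are the cube roots of m and 2, [S0] is E S(0), and [W] is the sum of E S(t)
    for t <= k. *)
Variables (nr a b mu eta Q D2 W S0 lnm m c c2 : R).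
Hypotheses (nr2 : 2 <= nr) (mu0 : 0 < mu) (amu : 1 / mu <= a)
  (eta0 : 0 < eta) (eta1 : eta <= 1) (Q0 : 0 <= Q) (D20 : 0 <= D2)
  (S0_ge0 : 0 <= S0) (S0le : S0 <= 2 * (a ^+ 2 * Q)) (lnm0 : 0 <= lnm)
  (c20 : 0 < c2) (c2lo : 3 / 2 <= c2 ^+ 2) (c2hi : c2 <= 4 / 3)
  (c2X : c2 ^+ 3 = 2) (c0 : 1 < c) (cX : c ^+ 3 = m) (m2 : 2 <= m)
  (beta0 : R) (bE : b = beta0 * c2 ^+ 2) (beta58 : 5 / 8 <= beta0)
  (beta1 : beta0 < 1).
Hypothesis hW : (2 * a * mu - 1) * W <= S0
  + 3 / 2 * (nr * b ^+ 2 * D2 / 4 + 8 * a ^+ 2 * Q / (b * eta)) * (c ^+ 2 - 1)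
  + a ^+ 2 * Q * lnm.

Let a0 : 0 < a. Proof. by apply: lt_le_trans amu; rewrite divr_gt0. Qed.
Let beta0_gt0 : 0 < beta0. Proof. by move: beta58; lra. Qed.
Let b0 : 0 < b. Proof. by rewrite bE mulr_gt0 // exprn_gt0. Qed.
Let amu1 : 1 <= a * mu. Proof. by rewrite -ler_pdivrMr. Qed.
Let Qa : 0 <= a ^+ 2 * Q. Proof. by rewrite mulr_ge0 ?sqr_ge0. Qed.
Let c21 : 0 <= c ^+ 2 - 1.
Proof.
have c1 := ltW c0; have c0' := le_trans ler01 c1.
by rewrite subr_ge0 expr_ge1.
Qed.

Let m1 : 0 < m - 1. Proof. by move: m2; lra. Qed.
Let m0 : 0 < m. Proof. by move: m2; lra. Qed.
Let nr0 : 0 <= nr. Proof. by move: nr2; lra. Qed.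

(** As [m >= 2], 1 / (m - 1) <= 2 / m, and [S0le] bounds the numerator by 2 a^2 Q (1 + lnm). The
    resulting 4 is at most (6/4) / (1 - beta0), because beta0 >= 5/8. *)
Lemma log_term : (S0 + a ^+ 2 * Q * lnm) / (m - 1) <=
  6 * Q * (a / 2) ^+ 2 * (1 + lnm) / (1 - beta0) * (1 / m).
Proof.
have h1 : S0 + a ^+ 2 * Q * lnm <= 2 * (a ^+ 2 * Q) * (1 + lnm).
  by have := mulr_ge0 Qa lnm0; move: S0le; lra.
have h0 : 0 <= a ^+ 2 * Q * (1 + lnm) by rewrite mulr_ge0 // addr_ge0.
apply: (@le_trans _ _ (4 * (a ^+ 2 * Q * (1 + lnm)) / m)).
  rewrite ler_pdivrMr // [X in _ <= X]mulrAC ler_pdivlMr //.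
  have hm : 0 <= m - 2 by rewrite subr_ge0.
  by have := ler_wpM2r (ltW m0) h1; have := mulr_ge0 h0 hm; lra.
rewrite mul1r ler_wpM2r ?invr_ge0 ?(ltW m0) // ler_pdivlMr ?subr_gt0 //.
have hb : 0 <= beta0 - 5 / 8 by rewrite subr_ge0.
by have := mulr_ge0 h0 hb; lra.
Qed.

(** Here b^2 = beta0^2 c2^4 = 2 c2 beta0^2, and (3/8) 2 c2 <= 1 because c2 <= 4/3. *)
Lemma grid_term : 3 / 2 * (nr * b ^+ 2 * D2 / 4) <= nr * D2 * beta0 ^+ 2.
Proof.
have -> : 3 / 2 * (nr * b ^+ 2 * D2 / 4) =
    3 / 8 * (c2 ^+ 3 * c2) * (nr * D2 * beta0 ^+ 2) by rewrite bE; field.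
rewrite c2X ler_piMl //; last by move: c2hi; lra.
by rewrite mulr_ge0 ?sqr_ge0 // mulr_ge0.
Qed.

Lemma gradient_term : 3 / 2 * (8 * a ^+ 2 * Q / (b * eta)) / (a * mu) <=
  4 * Q * (a / 2) ^+ 2 / (beta0 * mu)
  + 27 * nr * Q * (a / 2) / (beta0 * eta ^+ 3).
Proof.
have c22 : 0 < c2 ^+ 2 by rewrite exprn_gt0.
have Qab : 0 <= Q * a / beta0 by rewrite divr_ge0 ?mulr_ge0 // ltW.
(* Dividing by [Q * a / beta0] leaves 12 / c2^2 h p <= a p + (27/2) n h^3. The left side is at most
   8 h p <= p^2 + 16 h^2; then p <= a, n >= 2 and h >= 1. *)
pose p := mu^-1; pose h := eta^-1.
have p0 : 0 < p by rewrite invr_gt0.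
have h1 : 1 <= h by rewrite invf_ge1.
have pa : p <= a by rewrite -[p]mul1r.
have -> : 3 / 2 * (8 * a ^+ 2 * Q / (b * eta)) / (a * mu) =
    Q * a / beta0 * (12 / c2 ^+ 2 * (h * p)).
  by rewrite bE /h /p; field; rewrite !gt_eqF.
have -> : 4 * Q * (a / 2) ^+ 2 / (beta0 * mu)
    + 27 * nr * Q * (a / 2) / (beta0 * eta ^+ 3)
  = Q * a / beta0 * (a * p + 27 / 2 * nr * h ^+ 3).
  by rewrite /h /p; field; rewrite !gt_eqF.
rewrite ler_wpM2l //.
have hp0 : 0 <= h * p by rewrite mulr_ge0 //; lra.
apply: (@le_trans _ _ (8 * (h * p))).
  by rewrite ler_wpM2r // ler_pdivrMr //; move: c2lo; lra.
apply: (@le_trans _ _ (p * p + 27 * h ^+ 2)).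
  by have := sqr_ge0 (p - 4 * h); have := sqr_ge0 h; lra.
apply: lerD; first by rewrite ler_wpM2r // ltW.
apply: ler_pM => //; last by rewrite ler_weXn2l.
- by rewrite sqr_ge0.
- by move: nr2; lra.
Qed.

Lemma average_bound : W / (m - 1) <=
  6 * Q * (a / 2) ^+ 2 * (1 + lnm) / (1 - beta0) * (1 / m)
  + (nr * D2 * beta0 ^+ 2 + 4 * Q * (a / 2) ^+ 2 / (beta0 * mu)
     + 27 * nr * Q * (a / 2) / (beta0 * eta ^+ 3)) * (1 / c).
Proof.
pose th := 2 * a * mu - 1; pose U1 := nr * b ^+ 2 * D2 / 4.
pose U2 := 8 * a ^+ 2 * Q / (b * eta).
have U10 : 0 <= U1 by rewrite /U1 divr_ge0 // mulr_ge0 // mulr_ge0 // sqr_ge0.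
have U20 : 0 <= U2 by rewrite /U2 divr_ge0 ?mulr_ge0 ?sqr_ge0 // ltW.
have am0 : 0 < a * mu by rewrite mulr_gt0.
have th1 : 1 <= th by rewrite /th; move: amu1; lra.
have tham : a * mu <= th by rewrite /th; move: amu1; lra.
have th0 : 0 < th by rewrite (lt_le_trans _ th1).
(* The divisor [th] is bounded below in two ways: by 1 for the logarithmic and grid terms, and by
   [a * mu] for the gradient term, where this produces the factor 1 / mu. *)
have div1 y : 0 <= y -> y / th <= y by move=> y0; rewrite ler_pdivrMr // ler_peMr.
have divam y : 0 <= y -> y / th <= y / (a * mu).
  by move=> y0; rewrite ler_wpM2l // lef_pV2 // posrE.
set lg := S0 + a ^+ 2 * Q * lnm.
have lg0 : 0 <= lg by rewrite addr_ge0 // mulr_ge0.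
have Wle : W <= lg + (3 / 2 * U1 + 3 / 2 * U2 / (a * mu)) * (c ^+ 2 - 1).
  have : W <= (lg + 3 / 2 * U1 * (c ^+ 2 - 1) + 3 / 2 * U2 * (c ^+ 2 - 1)) / th.
    by rewrite ler_pdivlMr // mulrC; move: hW; rewrite -/th -/U1 -/U2 /lg; lra.
  move=> /le_trans; apply.
  have V1 : 0 <= 3 / 2 * U1 * (c ^+ 2 - 1) by rewrite mulr_ge0 // mulr_ge0 // divr_ge0.
  have V2 : 0 <= 3 / 2 * U2 * (c ^+ 2 - 1) by rewrite mulr_ge0 // mulr_ge0 // divr_ge0.
  have := div1 _ lg0; have := div1 _ V1; have := divam _ V2.
  have -> : 3 / 2 * U2 * (c ^+ 2 - 1) / (a * mu) =
      3 / 2 * U2 / (a * mu) * (c ^+ 2 - 1) by rewrite mulrAC.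
  by rewrite [X in _ -> _ -> _ -> X <= _]mulrDl mulrDl; lra.
(* With m = c^3 this reads c^3 - c <= c^3 - 1. *)
have ratio : (c ^+ 2 - 1) / (m - 1) <= 1 / c.
  have c00 : 0 < c by rewrite (lt_trans ltr01).
  rewrite ler_pdivrMr // mulrAC mul1r ler_pdivlMr // -cX.
  by move: c0; nra.
have U0 : 0 <= 3 / 2 * U1 + 3 / 2 * U2 / (a * mu).
  apply: addr_ge0; first by rewrite mulr_ge0 // divr_ge0.
  by apply: divr_ge0; [rewrite mulr_ge0 // divr_ge0|exact: ltW].
apply: (@le_trans _ _ ((lg + (3 / 2 * U1 + 3 / 2 * U2 / (a * mu))
    * (c ^+ 2 - 1)) / (m - 1))).
  by rewrite ler_wpM2r // invr_ge0 ltW.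
rewrite mulrDl -[X in _ + X <= _]mulrA; apply: lerD; first exact: log_term.
apply: le_trans (ler_wpM2l U0 ratio) _.
rewrite ler_wpM2r //; last by rewrite -addrA; exact: lerD grid_term gradient_term.
by rewrite mul1r invr_ge0 (le_trans ler01) // ltW.
Qed.

End Summation.

(** * Convergence rate *)

Section BoxDiameter.
Variables (R : realType) (d : nat) (l u : 'rV[R]_d).

Lemma fnorm_box_le v w : box l u v -> box l u w ->
  fnorm (v - w) ^+ 2 <= fnorm (u - l) ^+ 2.
Proof.
move=> bv bw; rewrite !fnorm_sqr; apply: ler_sum => m _; rewrite !mxE.
have /andP[v1 v2] := bv m; have /andP[w1 w2] := bw m.
rewrite -!expr2 -[_ ^+ 2]real_normK ?num_real // ler_pXn2r ?nnegrE //.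
  by rewrite ler_norml; apply/andP; split; lra.
by lra.
Qed.

(** Adding strong convexity from [l] to [u] and from [u] to [l] gives mu |u - l|^2 <= <g u - g l, u
    - l>, which Cauchy-Schwarz bounds by 2 K |u - l|. *)
Lemma strongly_convex_diameter (f : 'rV[R]_d -> R) g (mu K : R) :
  (forall m, l 0 m <= u 0 m) -> strongly_convex_on (box l u) mu f g ->
  (forall y, box l u y -> fnorm (g y) <= K) ->
  mu * fnorm (u - l) <= 2 * K.
Proof.
move=> lu hf hg; have bl : box l u l by move=> m; rewrite lexx lu.
have bu : box l u u by move=> m; rewrite lexx lu.
have [D0|D0] := eqVneq (fnorm (u - l)) 0.
  by rewrite D0 mulr0 mulr_ge0 // (le_trans (fnorm_ge0 (g l))) // hg.
have Dp : 0 < fnorm (u - l) by rewrite lt0r D0 fnorm_ge0.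
have h1 := hf _ _ bl bu; have h2 := hf _ _ bu bl.
rewrite -(opprB u l) dotNr fnormN in h2.
have bd v : fnorm v <= K -> dot v (u - l) <= K * fnorm (u - l).
  by move=> vK; apply: le_trans (dot_le_fnorm _ _) (ler_wpM2r (ltW Dp) vK).
have h3 := bd _ (hg u bu); have h4 := bd (- g l).
rewrite fnormN dotNl in h4; have {}h4 := h4 (hg l bl).
rewrite -(ler_pM2r Dp); move: h1 h2; rewrite expr2; lra.
Qed.

End BoxDiameter.

(** With [c ^+ 3] = k + 2, this is the one-step error multiplied by k + 2. The gradient-noise term
    decays faster, like 1 / c^2; [b ^+ 2 * eta <= 2 * c] absorbs it into the 1 / c term, raising the
    coefficient 6 to 8. *)
Lemma step_error_le (R : realType) (a b c Q V D2 nr eta : R) :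
  0 < a -> 0 < b -> 0 < c -> 0 <= Q -> 0 <= nr -> 0 < eta ->
  V <= D2 / 4 -> b ^+ 2 * eta <= 2 * c ->
  c ^+ 3 * (6 * (a / c ^+ 3) ^+ 2 * Q / (b / c ^+ 2 * eta)
    + (a / c ^+ 3) ^+ 2 * Q
    + (nr * (b / c ^+ 2) ^+ 2 * V
       + 2 * (a / c ^+ 3) * (b / c ^+ 2) * (Q * (a / 2)))) <=
  (nr * b ^+ 2 * D2 / 4 + 8 * a ^+ 2 * Q / (b * eta)) / c
    + a ^+ 2 * Q / c ^+ 3.
Proof.
move=> a0 b0 c0 Q0 nr0 eta0 VD hb.
have -> : c ^+ 3 * (6 * (a / c ^+ 3) ^+ 2 * Q / (b / c ^+ 2 * eta)
    + (a / c ^+ 3) ^+ 2 * Q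
    + (nr * (b / c ^+ 2) ^+ 2 * V
       + 2 * (a / c ^+ 3) * (b / c ^+ 2) * (Q * (a / 2)))) =
  (nr * b ^+ 2 * V + 6 * a ^+ 2 * Q / (b * eta)
    + a ^+ 2 * Q / (b * eta) * (b ^+ 2 * eta / c)) / c + a ^+ 2 * Q / c ^+ 3.
  by field; rewrite !gt_eqF.
rewrite lerD2r ler_wpM2r ?invr_ge0 ?(ltW c0) //.
have h1 : nr * b ^+ 2 * V <= nr * b ^+ 2 * D2 / 4.
  by rewrite -[X in _ <= X]mulrA ler_wpM2l // mulr_ge0 // sqr_ge0.
set K := a ^+ 2 * Q / (b * eta).
have K0 : 0 <= K.
  by rewrite divr_ge0 // ?(mulr_ge0 (sqr_ge0 a)) // mulr_ge0 // ltW.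
have h2 : K * (b ^+ 2 * eta / c) <= K * 2 by rewrite ler_wpM2l // ler_pdivrMr.
have eK z : z * a ^+ 2 * Q / (b * eta) = z * K by rewrite /K !mulrA.
by rewrite !eK; lra.
Qed.


Theorem theorem3 (R : realType) (n d : nat)
  (l u Delta : 'rV[R]_d) (N : 'I_d -> nat)
  (f : 'I_n -> 'rV[R]_d -> R) (g : 'I_n -> 'rV[R]_d -> 'rV[R]_d)
  (Li mui : 'I_n -> R) (mu : R)
  (E : rel 'I_n) (A : 'M[R]_n) (sigma2 : R)
  (disp : measure_display) (T : measurableType disp) (P : probability T R)
  (x q z : process T R n d) (a b : R) (xs : 'rV[R]_d) :
  let X := box l u in
  let alpha := step_alpha a in
  let beta := step_beta b in
  let L := \sum_(i < n) Li i in
  let D := \sum_(m < d) Delta 0 m in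
  forall
  (hgrid : uniform_grid l u Delta N)
  (hLi : forall i, 0 <= Li i)
  (hconvex : forall i, convex_on X (f i))
  (hlip : forall i, lipschitz_bound_on X (Li i) (f i))
  (hsub : forall i y, X y -> subgradient_on X (f i) y (g i y))
  (hgL : forall i y, X y -> fnorm (g i y) <= Li i)
  (hstrong : forall i, strongly_convex_on X (mui i) (f i) (g i))
  (hmu : is_min mui mu) (mu_gt0 : 0 < mu)
  (hE : connected_undirected E)
  (hA : weight_matrix E A)
  (hsigma : second_singular_value A sigma2) (hsigma01 : 0 < sigma2 < 1)
  (ha : 1 / mu <= a) (hb : 1 / (1 - sigma2) <= b) (hbeta : beta 0%N < 1)
  (hx : random_process x) (hq : random_process q)
  (hfresh : fresh_quantization P l Delta x q)
  (halg : quantized_subgradient X E A g alpha beta x q)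
  (hz : z = time_average x)
  (hxs : minimizer_on X (fun y => \sum_(i < n) f i y) xs)
  (i : 'I_n) (k : nat),
  let Er0 := fine 'E_P[fun w => fnorm (mean x 0 w - xs) ^+ 2] in
  let EY0 := fine 'E_P[fun w => fnorm (deviation x 0 w)] in
  ('E_P[fun w => (fnorm (z i k w - xs) ^+ 2)%R] <=
    ((n%:R * Er0
      + 4 * n%:R * EY0 * (1 + ln k.+2%:R) / (1 - sigma2)
      + 6 * L ^+ 2 * alpha 0%N ^+ 2 * (1 + ln k.+2%:R) / (1 - beta 0%N))
       * (1 / k.+2%:R)
     + (n%:R * D ^+ 2 * beta 0%N ^+ 2
        + 4 * L ^+ 2 * alpha 0%N ^+ 2 / (beta 0%N * mu)
        + 8 * n%:R ^+ 2 * sigma2 ^+ 2 * D ^+ 2 * beta 0%N ^+ 2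
            / (1 - sigma2) ^+ 2
        + 27 * n%:R * L ^+ 2 * alpha 0%N / (beta 0%N * (1 - sigma2) ^+ 3))
       * (1 / k.+2%:R `^ (1 / 3)))%:E)%E.
Proof.
move=> X alpha beta L D hgrid hLi _ hlip _ hgL hstrong hmu mu_gt0 _ hA hsigma
  /andP[sigma0 sigma1] ha hb hbeta hx hq hfresh halg -> hxs i k.
lazy zeta; set Er0 := fine _; set EY0 := fine _.
have [n1 _] := hsigma; have n0 : (0 < n)%N := ltnW n1.
have nR : (2 : R) <= n%:R by rewrite ler_nat.
pose c j := (j%:R : R) `^ (1 / 3).
have [/andP[c2lo c2hi] c2le] := @cbrt2_bounds R.
have c2X : c 2%N ^+ 3 = 2 by exact: powR13X.
have c20 : 0 < c 2%N by exact: cbrt_gt0.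
have betaE j : beta j = b / c j.+2 ^+ 2 by rewrite /beta /step_beta powR23E.
have c22 : 0 < c 2%N ^+ 2 by rewrite exprn_gt0.
have bE : b = beta 0%N * c 2%N ^+ 2 by rewrite betaE divfK // gt_eqF.
have eta0 : 0 < 1 - sigma2 by rewrite subr_gt0.
(* As beta(0) < 1, [b] is below 2^(2/3) <= 8/5. Together with 1 <= 1 / (1 - sigma2) <= b this yields
   sigma2 <= 3/8 and beta(0) >= 5/8. *)
have beta0lt : b < 8 / 5.
  by rewrite bE (lt_le_trans _ c2hi) // -[ltRHS]mul1r ltr_pM2r.
have b1 : 1 <= b.
  by apply: le_trans hb; rewrite ler_pdivlMr // mul1r; lra.
have b0 : 0 < b by rewrite (lt_le_trans ltr01).
have sigma38 : sigma2 <= 3 / 8.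
  by move: hb; rewrite ler_pdivrMr // => hb; nra.
have beta58 : 5 / 8 <= beta 0%N.
  by rewrite betaE ler_pdivlMr //; move: c2hi; rewrite -/(c 2%N); lra.
have a0 : 0 < a by apply: lt_le_trans ha; rewrite divr_gt0.
have L0 : 0 <= L by exact: sumr_ge0.
have [muj mu_le] := hmu.
have [A0 rows cols] : doubly_stochastic A by case: hA.
(* Weights vanish off the edges, so neighbour sums extend to all nodes. *)
have AE i' j : E i' j = false -> A i' j = 0.
  case: hA => pos _ _ _; rewrite -pos => /negbT; rewrite -leNgt => Ale.
  by apply/eqP; rewrite eq_le Ale A0.
have Xx i' t w : X (x i' t w).
  by case: halg => h0 h1; case: t => [|t]; [exact: h0|case: (h1 i' t w)].
have hproj t i' w : is_proj X ((1 - beta t) *: x i' t w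
     + beta t *: (\sum_j A i' j *: q j t w) - alpha t *: g i' (x i' t w))
     (x i' t.+1 w).
  have [_ /(_ i' t w)] := halg; rewrite big_mkcond.
  rewrite (eq_bigr (fun j => A i' j *: q j t w)) // => j _.
  by case: ifP => // /AE ->; rewrite scale0r.
have lu m : l 0 m <= u 0 m.
  by have [Dm ->] := hgrid m; rewrite lerDl mulr_ge0 // ltW.
set V := \sum_m Num.min (Delta 0 m) ((N m)%:R * Delta 0 m) ^+ 2 / 4.
have D0 m : 0 < Delta 0 m by case: (hgrid m).
have min0 m : 0 <= Num.min (Delta 0 m) ((N m)%:R * Delta 0 m).
  by rewrite le_min (ltW (D0 m)) mulr_ge0 // ltW.
have VD : V <= D ^+ 2 / 4.
  rewrite /V -mulr_suml ler_wpM2r ?invr_ge0 // expr2 /D mulr_suml.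
  apply: ler_sum => m _; apply: (@le_trans _ _ (Delta 0 m ^+ 2)).
    by rewrite ler_pXn2r ?nnegrE ?ge_min ?lexx // ltW.
  rewrite expr2 ler_wpM2l ?(ltW (D0 m)) // (bigD1 m) //= lerDl sumr_ge0 //.
  by move=> m' _; exact: ltW.
set diam := fnorm (u - l).
have Vdiam : V <= diam ^+ 2 / 4.
  rewrite /V -mulr_suml ler_wpM2r ?invr_ge0 // /diam fnorm_sqr.
  apply: ler_sum => m _; rewrite !mxE -expr2 ler_pXn2r ?nnegrE ?subr_ge0 //.
  by have [_ ->] := hgrid m; rewrite addrC addKr ge_min lexx orbT.
have diam0 : 0 <= diam by exact: fnorm_ge0.
(* The diameter bound is summed over the nodes; with [a * mu >= 1] it gives [La]. *)
have Ldiam : n%:R * (mu * diam) <= 2 * L.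
  rewrite mulr_sumr mulr_natl -[X in _ *+ X](card_ord n) -sumr_const.
  apply: ler_sum => i' _; apply: strongly_convex_diameter (hgL i') => //.
  by move=> y w hy hw; have := hstrong i' y w hy hw; apply: le_trans;
    rewrite ler_wpM2r ?sqr_ge0 // ler_pM2r.
have La : n%:R * diam / 2 <= L * a.
  have amu : 1 <= a * mu by rewrite -ler_pdivrMr.
  have nd : 0 <= n%:R * diam by rewrite mulr_ge0.
  have := ler_wpM2l (ltW a0) Ldiam; have := ler_wpM2r nd amu; lra.
(* [lam] is alpha(0) L, large enough since V <= diam^2 / 4 and diam <= L a. *)
set lam := a / 2 * L.
have lam0 : 0 <= lam by rewrite mulr_ge0 // divr_ge0 // ltW.
have lam_gt0 : 0 < L -> 0 < lam by move=> Lp; rewrite mulr_gt0 // divr_gt0.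
have diamL : diam <= L * a.
  apply: le_trans La; rewrite mulrAC ler_peMl //.
  by rewrite ler_pdivlMr // mul1r.
have Vlam : V <= lam ^+ 2.
  apply: (le_trans Vdiam).
  have -> : lam ^+ 2 = (L * a) ^+ 2 / 4 by rewrite /lam; field.
  by rewrite ler_wpM2r ?invr_ge0 // ler_pXn2r ?nnegrE // mulr_ge0 // ltW.
have cj0 j : 0 < c j.+1 by exact: cbrt_gt0.
have cjX j : c j ^+ 3 = j%:R by exact: powR13X.
have cle j : c 2%N <= c j.+2 by exact: le_cbrt.
have beta_gt0 j : 0 < beta j by rewrite betaE divr_gt0 // exprn_gt0.
have beta_le1 j : beta j <= 1.
  apply: le_trans (ltW hbeta); rewrite !betaE ler_wpM2l ?(ltW b0) //.
  by rewrite lef_pV2 ?posrE ?exprn_gt0 // ler_pXn2r ?nnegrE // ltW.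
have alphaE j : alpha j = a / c j.+2 ^+ 3 by rewrite cjX.
have alpha_ge0 j : 0 <= alpha j by rewrite alphaE divr_ge0 ?exprn_ge0 // ltW.
pose ES t := \int[P]_w \sum_i fnorm (x i t w - xs) ^+ 2.
have step t : ES t.+1 <= (1 - 2 * alpha t * mu) * ES t
    + (6 * alpha t ^+ 2 * L ^+ 2 / (beta t * (1 - sigma2))
       + alpha t ^+ 2 * L ^+ 2
       + (n%:R * beta t ^+ 2 * V + 2 * alpha t * beta t * L * lam)).
  apply: (@step_Exp _ _ _ P _ _ l u Delta xs N f g Li mui mu A sigma2 (alpha t)
    (beta t) x q t) => //.
  - by rewrite (ltW sigma0) sigma38.
  - by rewrite beta_gt0 beta_le1.
pose C1 := n%:R * b ^+ 2 * D ^+ 2 / 4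
  + 8 * a ^+ 2 * L ^+ 2 / (b * (1 - sigma2)).
pose C2 := a ^+ 2 * L ^+ 2.
have C20 : 0 <= C2 by rewrite mulr_ge0 // sqr_ge0.
have C10 : 0 <= C1.
  apply: addr_ge0; first by rewrite divr_ge0 // mulr_ge0 ?sqr_ge0 // mulr_ge0 ?sqr_ge0.
  by rewrite divr_ge0 ?mulr_ge0 ?sqr_ge0 // ltW.
have rec t : t.+2%:R * ES t.+1 <= (t.+2%:R - 2 * a * mu) * ES t
    + (C1 / c t.+2 + C2 / t.+2%:R).
  (* Since c2^3 = 2, b^2 = 2 c2 beta(0)^2, which is below 2 c2. *)
  have b2 : b ^+ 2 * (1 - sigma2) <= 2 * c t.+2.
    have e2 : b ^+ 2 = beta 0%N ^+ 2 * (2 * c 2%N).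
      by rewrite bE -c2X; ring.
    apply: (@le_trans _ _ (b ^+ 2)).
      by rewrite ler_piMr ?sqr_ge0 //; lra.
    rewrite e2; apply: (@le_trans _ _ (2 * c 2%N)).
      by rewrite ler_piMl ?mulr_ge0 ?(ltW c20) // expr_le1 // ltW.
    by rewrite ler_pM2l.
  have := @step_error_le R a b (c t.+2) (L ^+ 2) V (D ^+ 2) n%:R (1 - sigma2)
    a0 b0 (cj0 _) (sqr_ge0 L) (ler0n _ _) eta0 VD b2.
  rewrite -alphaE -betaE cjX -/C1 -/C2.
  have -> : 2 * alpha t * beta t * (L ^+ 2 * (a / 2))
      = 2 * alpha t * beta t * L * lam by rewrite /lam; ring.
  move=> err; have t0 : (0 : R) <= t.+2%:R by [].
  have := ler_wpM2l t0 (step t).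
  have -> : (t.+2%:R - 2 * a * mu) * ES t =
      t.+2%:R * ((1 - 2 * alpha t * mu) * ES t).
    have : (t.+2%:R : R) != 0 by rewrite pnatr_eq0.
    by rewrite /alpha /step_alpha; move: (t.+2%:R) (ES t) => y s y0; field.
  rewrite [X in _ <= X -> _]mulrDr => /le_trans; apply.
  by rewrite lerD2l.
(* At index [k.+1] the sum covers the times 0 to k averaged by [z]; the extra term in [ES k.+1] is
   nonnegative and is dropped below. *)
have sumS := sum_recursion C10 C20 rec k.+1.
have ES_ge0 t : 0 <= ES t.
  by apply: Rintegral_ge0 => w _; apply: sumr_ge0 => j _; rewrite sqr_ge0.
have bS t : ae_bounded P (fun w => \sum_i fnorm (x i t w - xs) ^+ 2).
  by apply: (@ae_bounded_sum_sqr _ _ _ P _ _ l u).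
have [Xxs _] := hxs.
(* As n >= 2, n diam^2 <= 2 (n diam / 2)^2 <= 2 (L a)^2. *)
have ES0le : ES 0%N <= 2 * (a ^+ 2 * L ^+ 2).
  apply: (@le_trans _ _ (n%:R * diam ^+ 2)).
    rewrite -[leRHS](Exp_cst P); apply: le_Exp => //.
      exact: ae_bounded_cst.
    move=> w; rewrite mulr_natl -[X in _ *+ X](card_ord n) -sumr_const.
    by apply: ler_sum => j _; exact: fnorm_box_le (Xx j 0%N w) Xxs.
  have -> : a ^+ 2 * L ^+ 2 = (L * a) ^+ 2 by ring.
  have h1 : (n%:R * diam / 2) ^+ 2 <= (L * a) ^+ 2.
    have La0 : 0 <= L * a by rewrite mulr_ge0 // ltW.
    by rewrite ler_pXn2r ?nnegrE // divr_ge0 // mulr_ge0.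
  have h2 : 0 <= (n%:R - 2) * (n%:R * diam ^+ 2) :> R.
    by rewrite mulr_ge0 ?subr_ge0 // mulr_ge0 // sqr_ge0.
  lra.
have m2 : (2 : R) <= k.+2%:R by rewrite ler_nat.
have c1 : 1 < c k.+2.
  by apply: lt_le_trans (cle k); move: c2lo; rewrite -/(c 2%N); nra.
pose W := \sum_(t < k.+1) ES t.
have avg : W / (k.+2%:R - 1) <=
  6 * L ^+ 2 * (a / 2) ^+ 2 * (1 + ln k.+2%:R) / (1 - beta 0%N) * (1 / k.+2%:R)
  + (n%:R * D ^+ 2 * beta 0%N ^+ 2
     + 4 * L ^+ 2 * (a / 2) ^+ 2 / (beta 0%N * mu)
     + 27 * n%:R * L ^+ 2 * (a / 2) / (beta 0%N * (1 - sigma2) ^+ 3))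
    * (1 / c k.+2).
  apply: (@average_bound _ n%:R a b mu (1 - sigma2) (L ^+ 2) (D ^+ 2) W (ES 0%N)
    (ln k.+2%:R) k.+2%:R (c k.+2) (c 2%N)) => //.
  - by rewrite gerBl ltW.
  - exact: sqr_ge0.
  - exact: sqr_ge0.
  - by rewrite ln_ge0 // ler1n.
  - apply: le_trans sumS; rewrite lerDl mulr_ge0 //.
(* Convexity bounds the error of the average by the average of the errors, and node [i] by the sum
   over all nodes. *)
have zE w : fnorm (time_average x i k w - xs) ^+ 2 <=
    k.+1%:R^-1 * \sum_(t < k.+1) \sum_j fnorm (x j t w - xs) ^+ 2.
  have k1 : (k.+1%:R : R) != 0 by rewrite pnatr_eq0.
  have -> : time_average x i k w - xs =
      \sum_(t < k.+1) k.+1%:R^-1 *: (x i t w - xs).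
    rewrite /time_average -scaler_sumr sumrB sumr_const card_ord scalerBr.
    by rewrite -[xs *+ _]scaler_nat scalerA mulVf // scale1r.
  apply: le_trans (@fnorm_sqr_convex R d _ (fun=> k.+1%:R^-1) _ _ _) _.
  - by move=> _; rewrite invr_ge0.
  - by rewrite sumr_const card_ord -[_ *+ _]mulr_natr mulVf.
  rewrite -mulr_sumr ler_wpM2l ?invr_ge0 //; apply: ler_sum => t _.
  by rewrite (bigD1 i) //= lerDl sumr_ge0 // => j _; rewrite sqr_ge0.
have bz : ae_bounded P (fun w => fnorm (time_average x i k w - xs) ^+ 2).
  have -> : (fun w => fnorm (time_average x i k w - xs) ^+ 2) = (fun w =>
      \sum_m (k.+1%:R^-1 * (\sum_(t < k.+1) x i t w 0 m) - xs 0 m) ^+ 2).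
    apply/funext => w; rewrite fnorm_sqr; apply: eq_bigr => m _.
    by rewrite !mxE summxE expr2.
  apply: ae_bounded_sum => m; apply: ae_boundedX; apply: ae_boundedB.
    by apply: ae_boundedZ; apply: ae_bounded_sum => t; exact: (@ae_bounded_state _ _ _ P _ _ l u).
  exact: ae_bounded_cst.
have Ez : \int[P]_w (fnorm (time_average x i k w - xs) ^+ 2) <=
    W / (k.+2%:R - 1).
  have bSS : ae_bounded P
      (fun w => \sum_(t < k.+1) \sum_j fnorm (x j t w - xs) ^+ 2).
    by apply: ae_bounded_sum => t; exact: bS.
  apply: le_trans (le_Exp bz (ae_boundedZ _ bSS) zE) _.
  rewrite ExpZ // Exp_sum; last by move=> t; exact: bS.
  by rewrite mulrC -[k.+2%:R]natr1 addrK.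
rewrite unlock -[X in (X <= _)%E]fineK; last first.
  exact/integrable_fin_num/ae_bounded_integrable.
rewrite lee_fin; apply: (le_trans Ez); apply: (le_trans avg).
(* The stated bound exceeds [avg] by the terms in [Er0], [EY0] and [sigma2 ^+ 2], all
   nonnegative. *)
have Er0_ge0 : 0 <= Er0.
  by rewrite fine_ge0 // expectation_ge0 // => w; rewrite sqr_ge0.
have EY0_ge0 : 0 <= EY0.
  by rewrite fine_ge0 // expectation_ge0 // => w; rewrite fnorm_ge0.
have ln0 : (0 : R) <= ln k.+2%:R by rewrite ln_ge0 // ler1n.
have alpha0E : alpha 0%N = a / 2 by [].
rewrite alpha0E; apply: lerD.
  rewrite ler_wpM2r ?divr_ge0 // lerDr.
  apply: addr_ge0; first exact: mulr_ge0.
  apply: divr_ge0 (ltW eta0); apply: mulr_ge0; last exact: addr_ge0.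
  by rewrite mulr_ge0 // mulr_ge0.
rewrite ler_wpM2r ?divr_ge0 ?powR_ge0 // lerD2r lerDl.
by apply: divr_ge0 (sqr_ge0 _); do 3![apply: mulr_ge0 (sqr_ge0 _)].
Qed.
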